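(* Let $\sigma_{k,l}$, $k\in\mathbb{N}_0$, $l=1,\dots,a_k$, be non-negative measures with support in $[0,\infty)$ such that for any $N\in\mathbb{N}_0$ $$C_N:=\sum_{k=0}^{\infty}\sum_{l=1}^{a_k}\int_0^\infty r^N r^{-k}\,d\sigma_{k,l}(r)<\infty .$$ Then for the functional $T:\mathbb{C}[x_1,\dots,x_d]\to\mathbb{C}$ defined by $$T(f):=\sum_{k=0}^{\deg f}\sum_{l=1}^{a_k}\int_0^\infty f_{k,l}(r)\,r^{-k}\,d\sigma_{k,l}(r),$$ where $f_{k,l}$ are the Laplace–Fourier coefficients of $f$, there exists a pseudo-positive, signed moment measure $\sigma$ on $\mathbb{R}^d$ such that $T(f)=\int_{\mathbb{R}^d} f\,d\sigma$ for all $f\in\mathbb{C}[x_1,\dots,x_d]$.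
   Context: $d\ge 1$ is an integer, $|x|$ is the Euclidean norm and $\mathbb{S}^{d-1}$ the unit sphere of $\mathbb{R}^d$ with surface measure $d\theta$ (for $d=1$, $\mathbb{S}^0=\{-1,1\}$ with mass $\tfrac12$ at each point). For each $k\in\mathbb{N}_0=\{0,1,2,\dots\}$, $Y_{k,1},\dots,Y_{k,a_k}:\mathbb{R}^d\to\mathbb{R}$ is a fixed basis of the space of harmonic homogeneous complex-valued polynomials of degree $k$, orthonormal with respect to $\langle f,g\rangle=\int_{\mathbb{S}^{d-1}}f(\theta)\overline{g(\theta)}\,d\theta$ (for $d=1$ the basis consists only of $Y_0(x)=1$ and $Y_1(x)=x$, so sums over $l$ with $k\ge 2$ are empty). The Laplace–Fourier coefficients of a continuous function $f$ are $f_{k,l}(r)=\int_{\mathbb{S}^{d-1}}f(r\theta)Y_{k,l}(\theta)\,d\theta$. For a polynomial $f$, $f_{k,l}(r)r^{-k}$ is a polynomial in $r^2$ (this defines its value at $r=0$) and vanishes for $k>\deg f$. By convention $r^{-k}=+\infty$ at $r=0$ for $k\ge1$. A signed measure on $\mathbb{R}^d$ is a real-valued $\sigma$-additive set function on the Borel sets; it is a moment measure if all polynomials are integrable with respect to its total variation. A signed measure $\mu$ on $\mathbb{R}^d$ is pseudo-positive if $\int_{\mathbb{R}^d}h(|x|)Y_{k,l}(x)\,d\mu(x)\ge0$ for every continuous compactly supported $h:[0,\infty)\to[0,\infty)$ and all $k\in\mathbb{N}_0$, $l=1,\dots,a_k$. *)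

(* Defs.v *)
From HB Require Import structures.
From mathcomp Require Import all_boot all_order all_algebra.
From mathcomp Require Import all_classical all_reals all_analysis.
From mathcomp Require Import measurable_realfun complex.
(* The notations of mpoly clash with those of the analysis library. *)
From mathcomp Require mpoly.
Export -(notations) mpoly.

Set Implicit Arguments.
Unset Strict Implicit.
Unset Printing Implicit Defensive.
Import Order.TTheory GRing.Theory Num.Theory.
Import numFieldNormedType.Exports.
Local Open Scope classical_set_scope.
Local Open Scope ring_scope.

(* R^d with its Borel sigma-algebra. *)
Definition euclidean (R : realType) (d : nat) :=
  g_sigma_algebraType (@open 'rV[R]_d).
HB.instance Definition _ (R : realType) (d : nat) :=
  Measurable.on (euclidean R d).

Section Euclidean.
Context {R : realType}.

(* The library norm of 'rV[R]_d is the maximum norm. *)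
Definition enorm d (x : euclidean R d) : R :=
  Num.sqrt (\sum_(i < d) (x ord0 i) ^+ 2).

Definition sphere d : set (euclidean R d) := [set x | enorm x = 1].

Lemma measurable_coord d (i : 'I_d) :
  measurable_fun [set: euclidean R d]
    (fun x : euclidean R d => x ord0 i : measurableTypeR R).
Proof.
apply: (measurability _ (RGenOInfty.measurableE R)) => _ [_ [a ->] <-].
rewrite setTI; apply: sub_sigma_algebra.
apply: (@open_comp _ _ (fun x : 'rV[R]_d => x ord0 i)).
  by move=> x _; exact: coord_continuous.
exact: interval_open.
Qed.

Lemma measurable_euclidean disp (T : measurableType disp) d
    (f : T -> euclidean R d) :
  (forall i, measurable_fun [set: T] (fun t => f t ord0 i : measurableTypeR R)) ->
  measurable_fun [set: T] f.
Proof.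
move=> mf; apply: (@measurability _ _ _ (euclidean R d) _ _ (@open 'rV[R]_d) erefl).
move=> _ [U oU <-]; rewrite setTI.
pose box (q : 'rV[rat]_d * nat) : set 'rV[R]_d :=
  [set x | forall i, `|ratr (q.1 ord0 i) - x ord0 i| < q.2.+1%:R^-1].
have mbox q : measurable (f @^-1` box q).
  rewrite (_ : _ @^-1` _ = \bigcap_(i in [set: 'I_d])
      (fun t => f t ord0 i : measurableTypeR R) @^-1`
        ball (ratr (q.1 ord0 i) : R) (q.2.+1%:R^-1)); last first.
    by apply/seteqP; split => t /= h i; [move=> _|]; apply: h.
  apply: fin_bigcap_measurable => // i _.
  rewrite -[X in measurable X]setTI; apply: mf => //.
  exact: measurable_ball.
have -> : f @^-1` U =
    \bigcup_(q : 'rV[rat]_d * nat)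
      (if `[< box q `<=` U >] then f @^-1` box q else set0).
  apply/seteqP; split => [t Uft|t [q _]]; last first.
    by case: ifPn => // /asboolP bU; exact: bU.
  have : nbhs (f t : 'rV[R]_d) U by apply: open_nbhs_nbhs; split.
  move=> /nbhs_ballP[e /= e0 eU].
  have [n ne] : exists n : nat, n.+1%:R^-1 < e / 2.
    have [n _ /(_ n (leqnn n))] := near_infty_natSinv_lt (PosNum (divr_gt0 e0 (ltr0Sn R 1))).
    by exists n.
  have dn : 0 < n.+1%:R^-1 :> R by rewrite invr_gt0 ltr0n.
  have qP i : exists q : rat, `|ratr q - f t ord0 i| < n.+1%:R^-1.
    have /rat_in_itvoo[q] : f t ord0 i - n.+1%:R^-1 < f t ord0 i + n.+1%:R^-1.
      by rewrite ltrD2l (lt_trans _ dn)// oppr_lt0.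
    by rewrite in_itv/= => qi; exists q; rewrite ltr_distl.
  pose q := \row_i sval (cid (qP i)).
  have bq : box (q, n) (f t) by move=> i /=; rewrite mxE; exact: (svalP (cid (qP i))).
  exists (q, n) => //; case: ifPn => [//|/asboolPn nbU]; exfalso; apply: nbU => x bx.
  apply: eU; split => // i j; rewrite (ord1 i) /ball/=.
  have := bq j; have := bx j => /= h1 h2.
  rewrite -(subrKA (ratr (q ord0 j))) (le_lt_trans (ler_normD _ _))//.
  by rewrite [ltRHS]splitr ltrD// ?(lt_trans _ ne)// distrC.
apply: countable_bigcupT_measurable => // q; case: ifPn => //.
Qed.

Lemma measurable_enorm d :
  measurable_fun [set: euclidean R d]
    (fun x : euclidean R d => enorm x : measurableTypeR R).
Proof.
apply: (@measurableT_comp _ _ _ _ _ _ (@Num.sqrt R)).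
  by apply: continuous_measurable_fun; exact: sqrt_continuous.
apply: measurable_sum => i; apply: measurable_funX; exact: measurable_coord.
Qed.

Definition image_measure d1 d2 (T1 : measurableType d1) (T2 : measurableType d2)
    (mu : {measure set T1 -> \bar R}) (f : T1 -> T2)
    (mf : measurable_fun [set: T1] f) : {measure set T2 -> \bar R} :=
  measure_function_pushforward__canonical__measure_function_Measure mu mf.

Definition cons_rV n (p : measurableTypeR R * euclidean R n) :
  euclidean R n.+1 := row_mx (p.1%:M : 'rV_1) p.2.

Lemma measurable_cons_rV n :
  measurable_fun [set: measurableTypeR R * euclidean R n] (@cons_rV n).
Proof.
apply: measurable_euclidean => i.
have [j ->|j ->] := split_ordP (i : 'I_(1 + n)).
  rewrite [X in measurable_fun _ X](_ : _ = fst); first exact: measurable_fst.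
  by apply/funext => p; rewrite [LHS]row_mxEl (ord1 j) mxE.
rewrite [X in measurable_fun _ X](_ : _ =
    (fun x : euclidean R n => x ord0 j : measurableTypeR R) \o snd); last first.
  by apply/funext => p; rewrite [LHS]row_mxEr.
by apply: (measurableT_comp (measurable_coord j)); exact: measurable_snd.
Qed.

Fixpoint lebesgue_rV d : {measure set (euclidean R d) -> \bar R} :=
  match d with
  | 0 => \d_((0 : 'rV[R]_0) : euclidean R 0)
  | n.+1 => image_measure (@lebesgue_measure R \x^ lebesgue_rV n)%E
                          (@measurable_cons_rV n)
  end.

Lemma measurable_inv_real :
  measurable_fun [set: measurableTypeR R]
    (GRing.inv : measurableTypeR R -> measurableTypeR R).
Proof.
rewrite -(setUv [set 0 : R]); apply/measurable_funU => //.
  exact: measurableC.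
split; first exact: measurable_fun_set1.
apply: open_continuous_measurable_fun; first exact/closed_openC/accessible_closed_set1/hausdorff_accessible/Rhausdorff.
by move=> x; rewrite inE => /eqP x0; exact: inv_continuous.
Qed.

Definition direction d (x : euclidean R d) : euclidean R d :=
  (enorm x)^-1 *: (x : 'rV[R]_d).

Lemma measurable_direction d :
  measurable_fun [set: euclidean R d] (@direction d).
Proof.
apply: measurable_euclidean => i.
under eq_fun do rewrite /direction mxE.
apply: measurable_funM; last exact: measurable_coord.
exact: (measurableT_comp measurable_inv_real (@measurable_enorm d)).
Qed.

Definition punctured_ball d : set (euclidean R d) :=
  [set x | 0 < enorm x <= 1].

Lemma measurable_punctured_ball d : measurable (@punctured_ball d).
Proof.
rewrite (_ : @punctured_ball d =
    (fun x : euclidean R d => enorm x : measurableTypeR R) @^-1` `]0, 1]).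
  by rewrite -[X in measurable X]setTI; exact: measurable_enorm.
by apply/seteqP; split => x /=; rewrite in_itv.
Qed.

(* Surface measure of the unit sphere, as a measure on R^d carried by it: the
   measure of A is d times the Lebesgue measure of the cone
   {r t | t in A, 0 < r <= 1}, the total mass being the area of the sphere.  For
   d = 1 this gives mass 1 to each of the points -1 and 1, which is halved. *)
Definition surface_factor d : {nonneg R} :=
  if d == 1%N then (2^-1)%:nng else d%:R%:nng.

Definition surface_measure d : {measure set (euclidean R d) -> \bar R} :=
  mscale (surface_factor d)
    (image_measure (mrestr (lebesgue_rV d) (@measurable_punctured_ball d))
                   (@measurable_direction d)).

End Euclidean.

Section ComplexIntegral.
Context disp (T : measurableType disp) (R : realType).
Local Open Scope complex_scope.

Definition cintegrable (mu : {measure set T -> \bar R}) (D : set T)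
    (f : T -> R[i]) : Prop :=
  mu.-integrable D (fun x => (complex.Re (f x))%:E) /\
  mu.-integrable D (fun x => (complex.Im (f x))%:E).

Definition cintegral (mu : {measure set T -> \bar R}) (D : set T)
    (f : T -> R[i]) : R[i] :=
  (\int[mu]_(x in D) complex.Re (f x)) +i* (\int[mu]_(x in D) complex.Im (f x)).

End ComplexIntegral.

(* Integration against a signed measure nu, that is a charge, through its Jordan
   decomposition; the latter does not depend on the Hahn decomposition chosen. *)
Section SignedIntegral.
Context disp (T : measurableType disp) (R : realType).
Variable nu : {charge set T -> \bar R}.
Local Open Scope complex_scope.

Lemma exists_hahn :
  exists PN : set T * set T, hahn_decomposition nu PN.1 PN.2.
Proof. by have [P [N h]] := Hahn_decomposition nu; exists (P, N). Qed.

Definition hahn : hahn_decomposition nu _ _ := svalP (cid exists_hahn).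

Definition positive_part : {measure set T -> \bar R} := jordan_pos hahn.
Definition negative_part : {measure set T -> \bar R} := jordan_neg hahn.
Definition total_variation : {measure set T -> \bar R} :=
  charge_variation hahn.

Definition signed_integral (f : T -> R) : R :=
  \int[positive_part]_x f x - \int[negative_part]_x f x.

Definition csigned_integral (f : T -> R[i]) : R[i] :=
  signed_integral (fun x => complex.Re (f x)) +i*
  signed_integral (fun x => complex.Im (f x)).

End SignedIntegral.

Section Polynomials.
Context {R : realType} {d : nat}.
Local Open Scope complex_scope.

Definition peval (p : mpoly d R) (x : euclidean R d) : R :=
  meval (fun i => x ord0 i) p.

Definition cpeval (f : mpoly d R[i]) (x : euclidean R d) : R[i] :=
  meval (fun i => (x ord0 i)%:C) f.

Definition laplacian (p : mpoly d R[i]) : mpoly d R[i] :=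
  \sum_(i < d) mderiv i (mderiv i p).

Definition harmonic_homogeneous (k : nat) (p : mpoly d R[i]) : Prop :=
  p \is ishomog1 k mdeg /\ laplacian p = 0.

Definition sphere_product (f g : euclidean R d -> R[i]) : R[i] :=
  cintegral (surface_measure d) (sphere (d := d)) (fun t => f t * (g t)^*).

(* The basis polynomials are real valued, hence have real coefficients; they
   span over the complex numbers. *)
Variables (a : nat -> nat) (Y : forall k, 'I_(a k) -> mpoly d R).
Arguments Y : clear implicits.

Definition complexify (p : mpoly d R) : mpoly d R[i] :=
  map_mpoly (real_complex R) p.

Definition orthonormal_harmonic_basis : Prop :=
  (forall k,
    [/\ forall l, harmonic_homogeneous k (complexify (Y k l)),
        forall p, harmonic_homogeneous k p ->
          exists! c : {ffun 'I_(a k) -> R[i]},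
            p = \sum_(l < a k) c l *: complexify (Y k l)
      & forall l l' : 'I_(a k),
          sphere_product (cpeval (complexify (Y k l)))
                         (cpeval (complexify (Y k l'))) = (l == l')%:R]) /\
  (d = 1%N ->
    (forall l : 'I_(a 0%N), Y 0%N l = 1) /\
    (forall (l : 'I_(a 1%N)) (i : 'I_d), Y 1%N l = mpolyX R (mnm1 i))).

Definition laplace_fourier (f : euclidean R d -> R[i]) k (l : 'I_(a k))
    (r : R) : R[i] :=
  cintegral (surface_measure d) (sphere (d := d))
    (fun t => f (r *: (t : 'rV[R]_d)) * (peval (Y k l) t)%:C).

(* f_{k,l}(r) r^{-k}, extended to r = 0 by continuity. *)
Definition laplace_fourier_quotient (f : euclidean R d -> R[i]) k
    (l : 'I_(a k)) (r : R) : R[i] :=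
  let q s := laplace_fourier f l s * (s ^- k)%:C in
  if r == 0 then
    lim (complex.Re (q s) @[s --> 0^'+]) +i* lim (complex.Im (q s) @[s --> 0^'+])
  else q r.

(* mmeasure mdeg f is 1 + deg f, and 0 for f = 0. *)
Definition moment_functional
    (sigma : forall k, 'I_(a k) -> {measure set (measurableTypeR R) -> \bar R})
    (f : mpoly d R[i]) : R[i] :=
  \sum_(k < mmeasure mdeg f) \sum_(l < a k)
    cintegral (sigma k l) `[0, +oo[ (laplace_fourier_quotient (cpeval f) l).

(* In \bar R, 0^-1 is +oo. *)
Definition moment_bound
    (sigma : forall k, 'I_(a k) -> {measure set (measurableTypeR R) -> \bar R})
    (N : nat) : \bar R :=
  (\sum_(k <oo) \sum_(l < a k)
    \int[sigma k l]_(r in `[0%R, +oo[) ((r ^+ N)%:E * ((r ^+ k)%:E)^-1))%E.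

Definition moment_measure (mu : {charge set (euclidean R d) -> \bar R}) : Prop :=
  forall f : mpoly d R[i], cintegrable (total_variation mu) setT (cpeval f).

Definition pseudo_positive (mu : {charge set (euclidean R d) -> \bar R}) : Prop :=
  forall h : R -> R,
    {within `[0, +oo[, continuous h} ->
    (forall r, 0 <= r -> 0 <= h r) ->
    compact (closure [set r | 0 <= r /\ h r != 0]) ->
    forall k (l : 'I_(a k)),
      0 <= signed_integral mu (fun x => h (enorm x) * peval (Y k l) x).

End Polynomials.

(* Main.v *)
(* The measure sigma is assembled from the pieces r^-k Y_{k,l}(t) dsigma_{k,l}(r) dt,
   pushed forward along polar coordinates (r, t) |-> r t.  Orthonormality bounds the
   L^1 norms of the Y_{k,l} on the sphere uniformly, so the moment conditions make the
   positive and the negative parts of the pieces summable against every function of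
   polynomial growth, and the two sums are measures with all moments.  Integrating f
   against a piece gives int f_{k,l}(r) r^-k dsigma_{k,l}(r); for a polynomial f this
   vanishes when k > deg f, and for f = h(|x|) Y_{k,l}(x) only the piece (k,l)
   contributes, with a nonnegative value.

   Spherical orthogonality of a harmonic homogeneous p of degree k to the polynomials
   of degree < k is first obtained for the Gaussian weight, where integration by parts
   is a one-dimensional recursion on monomials; homogeneity of Lebesgue measure on
   cones then transfers it to the surface measure. *)
Require Import Defs.
From HB Require Import structures.
From mathcomp Require Import all_boot all_order all_algebra.
From mathcomp Require Import all_classical all_reals all_analysis.
From mathcomp Require Import measurable_realfun complex.
From mathcomp Require Import ring lra.

Set Implicit Arguments.
Unset Strict Implicit.
Unset Printing Implicit Defensive.
Import Order.TTheory GRing.Theory Num.Theory.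
Import numFieldNormedType.Exports.
Local Open Scope classical_set_scope.
Local Open Scope ring_scope.

(** * Densities and series of measures *)

(** Signs are allowed to cancel only at the very end. The densities are split into positive and
    negative parts, each family of parts is summed over all (k,l) as a series of non-negative
    measures, and only then is the difference of two finite measures taken. That difference need not
    be a Jordan decomposition, but its two terms dominate the Jordan parts, so integrability and
    integrals can be read off from it.

    The point r = 0 needs care: for k > 0 the factor r^-k is +oo there in the moment condition, but
    0 under the field inverse used in the densities. The condition for N = 0 excludes an atom at 0
    when k > 0, and for k = 0 there is no singularity. Finiteness of each sigma_{k,l} is derived as
    well: for N = k the integrand is 1 away from 0.

    The Gaussian serves because it is both a product over the coordinates, which reduces integration
    by parts to one variable, and a function of |x|, which separates in polar coordinates. The
    comparison with the sphere is only up to a nonzero radial constant, which is enough because only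
    the vanishing of integrals is transferred. *)

Section MeasureFacts.
Context disp (T : measurableType disp) (R : realType).
Local Open Scope ereal_scope.
Implicit Types m : {measure set T -> \bar R}.

(** The bound is an argument of the alias, so that a finite-measure structure can be attached to a
    measure whose finiteness is only a proved fact. *)
Definition finite_of m & m setT < +oo : set T -> \bar R := m.
HB.instance Definition _ m (mT : m setT < +oo) := Measure.copy (finite_of mT) m.
Let finite_of_fin m (mT : m setT < +oo) : fin_num_fun (finite_of mT).
Proof. exact: lty_fin_num_fun. Qed.
HB.instance Definition _ m (mT : m setT < +oo) :=
  @Measure_isFinite.Build _ _ _ (finite_of mT) (finite_of_fin mT).

Definition sigma_finite_of m & sigma_finite setT m : set T -> \bar R := m.
HB.instance Definition _ m (mT : sigma_finite setT m) := Measure.copy (sigma_finite_of mT) m.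
HB.instance Definition _ m (mT : sigma_finite setT m) :=
  @Measure_isSigmaFinite.Build _ _ _ (sigma_finite_of mT) mT.

Lemma measure_integrable_le m1 m2 (f : T -> \bar R) :
  (forall A, measurable A -> m1 A <= m2 A) ->
  m2.-integrable setT f -> m1.-integrable setT f.
Proof.
move=> m12 /integrableP[mf f2]; apply/integrableP; split => //.
apply: le_lt_trans f2; apply: ge0_le_measure_integral => //.
by apply/measurableT_comp.
Qed.

Lemma measure_add_integrable m1 m2 (f : T -> \bar R) :
  m1.-integrable setT f -> m2.-integrable setT f ->
  (measure_add m1 m2).-integrable setT f.
Proof.
move=> /integrableP[mf f1] /integrableP[_ f2]; apply/integrableP; split => //.
rewrite ge0_integral_measure_add//; first exact: lte_add_pinfty.
exact/measurableT_comp.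
Qed.

(** On a Hahn set P the positive part of m1 - m2 is A |-> m1 (A [&] P) - m2 (A [&] P), hence at most
    m1; likewise the negative part is at most m2. So whatever is integrable for m1 and m2 is
    integrable for the total variation. *)
Lemma charge_difference (m1 m2 : {finite_measure set T -> \bar R}) :
  exists mu : {charge set T -> \bar R}, forall f : T -> R,
    m1.-integrable setT (EFin \o f) -> m2.-integrable setT (EFin \o f) ->
    (Defs.total_variation mu).-integrable setT (EFin \o f) /\
    signed_integral mu f = (\int[m1]_x f x - \int[m2]_x f x)%R.
Proof.
pose mu : {charge set T -> \bar R} :=
  cadd (charge_of_finite_measure m1) (copp (charge_of_finite_measure m2)).
have muE A : mu A = m1 A - m2 A by [].
exists mu => f f1 f2.
have [[mP _] [mN _] _ _] := hahn mu.
have fin (m : {finite_measure set T -> \bar R}) A : measurable A -> m A \is a fin_num.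
  exact: fin_num_measure.
have J1 A : measurable A -> positive_part mu A <= m1 A.
  move=> mA; rewrite [leLHS](jordan_posE (hahn mu)) cjordan_posE /crestr0 mem_set// /crestr muE.
  rewrite (@le_trans _ _ (m1 (A `&` (sval (cid (exists_hahn mu))).1)))//.
    by rewrite geeDl// oppe_le0.
  by rewrite le_measure// ?inE//; exact: measurableI.
have J2 A : measurable A -> negative_part mu A <= m2 A.
  move=> mA; rewrite [leLHS](jordan_negE (hahn mu)) cjordan_negE /crestr0 mem_set// /crestr muE.
  rewrite fin_num_oppeB ?fin//; last exact: measurableI.
  rewrite (@le_trans _ _ (m2 (A `&` (sval (cid (exists_hahn mu))).2)))//.
    by rewrite addeC geeDl// oppe_le0.
  by rewrite le_measure// ?inE//; exact: measurableI.
have p1 : (positive_part mu).-integrable setT (EFin \o f) := measure_integrable_le J1 f1.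
have n2 : (negative_part mu).-integrable setT (EFin \o f) := measure_integrable_le J2 f2.
have mf := measurable_int _ f1.
split.
  apply: (measure_integrable_le _ (measure_add_integrable p1 n2)) => A mA.
  by rewrite [leRHS](measure_addE (positive_part mu) (negative_part mu)).
(* The identity mu^+ - mu^- = m1 - m2 is rearranged into an equality of sums of non-negative
   measures, which can be integrated directly. *)
have JE : \int[measure_add (positive_part mu) m2]_x (f x)%:E =
          \int[measure_add (negative_part mu) m1]_x (f x)%:E.
  apply: eq_measure_integral => A mA _.
  rewrite [LHS](measure_addE (positive_part mu) m2) [RHS](measure_addE (negative_part mu) m1).
  have := jordan_decomp (hahn mu) mA; rewrite muE /cadd/= cscaleN1/=.
  have : jordan_pos (hahn mu) A \is a fin_num.
    by rewrite ge0_fin_numE// (le_lt_trans (J1 _ mA))// ltey_eq fin.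
  have : jordan_neg (hahn mu) A \is a fin_num.
    by rewrite ge0_fin_numE// (le_lt_trans (J2 _ mA))// ltey_eq fin.
  have := fin m1 _ mA; have := fin m2 _ mA.
  case: (m1 A) => // a; case: (m2 A) => // b _ _.
  case: (jordan_neg _ A) => // c _; case: (jordan_pos _ A) => // e _ /=.
  by rewrite -!EFinD => -[] h; congr EFin; lra.
move: JE; rewrite !integral_measure_add// /signed_integral /Rintegral.
have := integrable_fin_num measurableT p1; have := integrable_fin_num measurableT n2.
have := integrable_fin_num measurableT f1; have := integrable_fin_num measurableT f2.
rewrite /=; move: (\int[_]_x _) (\int[_]_x _) (\int[_]_x _) (\int[_]_x _).
move=> [a||] [b||] [c||] [e||]//= _ _ _ _; rewrite -!EFinD => -[] h; lra.
Qed.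

End MeasureFacts.

Section Restriction.
Context disp (T : measurableType disp) (R : realType).
Local Open Scope ereal_scope.

Lemma ge0_integral_mrestr (mu : {measure set T -> \bar R}) (D : set T)
    (mD : measurable D) (f : T -> \bar R) :
  measurable_fun setT f -> (forall x, 0 <= f x) ->
  \int[mrestr mu mD]_x f x = \int[mu]_(x in D) f x.
Proof.
move=> mf f0.
rewrite (@ge0_negligible_integral _ _ _ _ setT (~` D))//; last 2 first.
- exact: measurableC.
- by rewrite /= /mrestr setICl measure0.
rewrite setTD setCK; apply: eq_measure_integral => A mA AD /=.
by rewrite /mrestr setIidl.
Qed.

End Restriction.

Section Density.
Context disp (T : measurableType disp) (R : realType).
Local Open Scope ereal_scope.

Definition hypograph (w : T -> R) : set (T * measurableTypeR R) :=
  [set z | 0 <= z.2 <= w z.1]%R.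

Lemma measurable_hypograph w : measurable_fun setT w -> measurable (hypograph w).
Proof.
move=> mw; rewrite (_ : hypograph w =
    [set: _] `&` [set z | 0 <= z.2]%R `&` ([set: _] `&` [set z | z.2 <= w z.1]%R)).
  apply: measurableI; apply: measurable_fun_le => //.
  exact: (measurableT_comp mw).
by apply/seteqP; split => [z /andP[]|z [[_ ? [_ ?]]]]/=; [|apply/andP].
Qed.

(* The density w is realized by integrating out the second coordinate of
   Lebesgue measure on the region under the graph of w. *)
Definition density (mu : {sigma_finite_measure set T -> \bar R}) (w : T -> R)
    (mw : measurable_fun setT w) : {measure set T -> \bar R} :=
  image_measure (mrestr (mu \x lebesgue_measure) (measurable_hypograph mw))
    (@measurable_fst _ _ T (measurableTypeR R)).

Context (mu : {sigma_finite_measure set T -> \bar R}) (w : T -> R).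
Context (mw : measurable_fun setT w) (w0 : forall x, (0 <= w x)%R).

(** Tonelli: the slice of the hypograph above x is [[0, w x]], of length w x. *)
Lemma ge0_integral_density (f : T -> R) :
  measurable_fun setT f -> (forall x, (0 <= f x)%R) ->
  \int[density mu mw]_x (f x)%:E = \int[mu]_x (f x * w x)%:E.
Proof.
move=> mf f0.
have mEf : measurable_fun setT (EFin \o f) by exact/measurable_EFinP.
rewrite ge0_integral_pushforward//; last by move=> x _; rewrite lee_fin.
have mff : measurable_fun setT ((EFin \o f) \o (@fst T (measurableTypeR R))).
  exact: measurableT_comp.
rewrite preimage_setT.
rewrite [LHS](ge0_integral_mrestr _ _ mff); last by move=> x; rewrite lee_fin.
rewrite integral_mkcond fubini_tonelli1//; last 2 first.
- by apply/(measurable_restrictT _ (measurable_hypograph mw)); exact: measurable_funTS.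
- by move=> x; rewrite patchE; case: ifPn => // _; rewrite lee_fin.
apply: eq_integral => x _; rewrite /fubini_F.
transitivity (\int[lebesgue_measure]_(t in `[0%R, w x]) (cst (f x)%:E t)).
  rewrite [RHS]integral_mkcond; apply: eq_integral => t _.
  rewrite !patchE; congr (if _ then _ else _).
rewrite integral_cst//= lebesgue_measure_itv/= lte_fin.
have [wx|] := ltP; first by rewrite sube0.
by rewrite le_eqVlt ltNge w0 orbF => /eqP->; rewrite mule0 mulr0.
Qed.

Lemma integral_density (f : T -> R) : measurable_fun setT f ->
  mu.-integrable setT (fun x => (f x * w x)%:E) ->
  (density mu mw).-integrable setT (EFin \o f) /\
  (\int[density mu mw]_x f x = \int[mu]_x (f x * w x))%R.
Proof.
move=> mf ifw; split.
  apply/integrableP; split; first exact/measurable_EFinP.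
  rewrite (eq_integral (fun x => (`|f x|)%:E))//.
  rewrite ge0_integral_density//; last exact: measurableT_comp.
  move/integrableP : ifw => [_]; apply: le_lt_trans.
  rewrite le_eqVlt; apply/orP; left; apply/eqP; apply: eq_integral => x _.
  by rewrite /= normrM (ger0_norm (w0 x)).
rewrite /Rintegral [in LHS]integralE [in RHS]integralE; congr (fine (_ - _)).
- rewrite (eq_integral (fun x => (Num.max (f x) 0)%:E)); last first.
    by move=> x _; rewrite funeposE /= EFin_max.
  rewrite ge0_integral_density.
  + apply: eq_integral => x _; rewrite funeposE -EFin_max maxr_pMl//.
    by rewrite mul0r.
  + exact: measurable_maxr.
  + by move=> x; rewrite le_max lexx orbT.
- rewrite (eq_integral (fun x => (Num.max (- f x) 0)%:E)); last first.
    by move=> x _; rewrite funenegE /= EFin_max.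
  rewrite ge0_integral_density.
  + apply: eq_integral => x _; rewrite funenegE -EFinN -EFin_max maxr_pMl//.
    by rewrite mul0r mulNr.
  + by apply: measurable_maxr => //; exact: measurableT_comp.
  + by move=> x; rewrite le_max lexx orbT.
Qed.

End Density.

Section SeriesOfMeasures.
Context disp (T : measurableType disp) (R : realType) (a : nat -> nat).
Variable m : forall k, 'I_(a k) -> {measure set T -> \bar R}.
Arguments m : clear implicits.
Local Open Scope ereal_scope.

(** [msum] ranges over natural numbers, hence the detour through [insub]; its default [mzero] is
    never reached below [a k]. *)
Definition finite_sum_measure k : {measure set T -> \bar R} :=
  msum (fun l : nat => if insub l is Some l' then m k l' else mzero) (a k).

Definition double_series_measure : {measure set T -> \bar R} :=
  mseries finite_sum_measure 0.

Lemma ge0_integral_double_series (f : T -> \bar R) :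
  measurable_fun setT f -> (forall x, 0 <= f x) ->
  \int[double_series_measure]_x f x =
  \sum_(k <oo) \sum_(l < a k) \int[m k l]_x f x.
Proof.
move=> mf f0; rewrite ge0_integral_measure_series//.
apply: eq_eseriesr => k _; rewrite ge0_integral_measure_sum//.
by apply: eq_bigr => l _; rewrite valK.
Qed.

Lemma double_series_setT :
  double_series_measure setT = \sum_(k <oo) \sum_(l < a k) m k l setT.
Proof.
rewrite -[LHS]mul1e -integral_cst// ge0_integral_double_series//.
by apply: eq_eseriesr => k _; apply: eq_bigr => l _; rewrite integral_cst// mul1e.
Qed.

Let summable_integral (f : T -> R) :=
  \sum_(k <oo) \sum_(l < a k) \int[m k l]_x `|(f x)%:E| < +oo.

Let double_series_integrable (f : T -> R) : measurable_fun setT f ->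
  summable_integral f -> double_series_measure.-integrable setT (EFin \o f).
Proof.
move=> mf sf; apply/integrableP; split; first exact/measurable_EFinP.
rewrite ge0_integral_double_series//.
by apply: measurableT_comp => //; exact/measurable_EFinP.
Qed.

Lemma summand_integrable (f : T -> R) k l : measurable_fun setT f ->
  summable_integral f -> (m k l).-integrable setT (EFin \o f).
Proof.
move=> mf sf; apply/integrableP; split; first exact/measurable_EFinP.
apply: le_lt_trans sf.
rewrite (@nneseriesD1 _ _ k)// => [|i _]; last first.
  by apply: sume_ge0 => j _; exact: integral_ge0.
rewrite (bigD1 l)//= -addeA leeDl// adde_ge0//.
  by apply: sume_ge0 => j _; exact: integral_ge0.
by apply: nneseries_ge0 => i _ _; apply: sume_ge0 => j _; exact: integral_ge0.
Qed.

Let partial_sum (f : T -> R) n :=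
  (\sum_(k < n) \sum_(l < a k) \int[m k l]_x f x)%R.

Let ge0_double_series_cvg (f : T -> R) : measurable_fun setT f ->
  (forall x, (0 <= f x)%R) -> summable_integral f ->
  partial_sum f n @[n --> \oo] --> (\int[double_series_measure]_x f x)%R.
Proof.
move=> mf f0 sf; apply: (@fine_cvg _ _ _ _ (fun n => (partial_sum f n)%:E)); rewrite fineK; last first.
  exact: (integrable_fin_num _ (double_series_integrable mf sf)).
rewrite ge0_integral_double_series//; last exact/measurable_EFinP.
rewrite [X in X @ _ --> _](_ : _ =
    (fun n => \sum_(0 <= k < n) \sum_(l < a k) \int[m k l]_x (f x)%:E)).
  apply: is_cvg_nneseries => k _ _; apply: sume_ge0 => l _.
  by apply: integral_ge0 => x _; rewrite lee_fin.
apply/funext => n.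
rewrite /partial_sum -sumEFin big_mkord; apply: eq_bigr => k _.
rewrite -sumEFin; apply: eq_bigr => l _; rewrite fineK//.
exact: (integrable_fin_num _ (summand_integrable _ mf sf)).
Qed.

(** The non-negative case is applied to f^+ and f^-, both summable because |f| dominates them. *)
Lemma double_series_integral (f : T -> R) : measurable_fun setT f ->
  \sum_(k <oo) \sum_(l < a k) \int[m k l]_x `|(f x)%:E| < +oo ->
  double_series_measure.-integrable setT (EFin \o f) /\
  (\sum_(k < n) \sum_(l < a k) \int[m k l]_x f x)%R @[n --> \oo] -->
     (\int[double_series_measure]_x f x)%R.
Proof.
move=> mf sf; split; first exact: double_series_integrable.
have sg (g : T -> R) : measurable_fun setT g -> (forall x, `|g x| <= `|f x|)%R -> summable_integral g.
  move=> mg gf; apply: le_lt_trans sf; apply: lee_nneseries => [k _ _|k _].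
    by apply: sume_ge0 => l _; exact: integral_ge0.
  apply: lee_sum => l _; apply: ge0_le_integral => //.
  - by apply: measurableT_comp => //; exact/measurable_EFinP.
  - by apply: measurableT_comp => //; exact/measurable_EFinP.
  - by move=> x _; rewrite lee_fin.
have mp : measurable_fun setT (f^\+)%R by exact: measurable_funrpos.
have mn : measurable_fun setT (f^\-)%R by exact: measurable_funrneg.
have sp : summable_integral (f^\+)%R.
  apply: sg => // x; rewrite ger0_norm ?funrpos_ge0//.
  have := congr1 (fun g => g x) (funrposDneg f) => /= <-.
  by rewrite lerDl funrneg_ge0.
have sn : summable_integral (f^\-)%R.
  apply: sg => // x; rewrite ger0_norm ?funrneg_ge0//.
  have := congr1 (fun g => g x) (funrposDneg f) => /= <-.
  by rewrite lerDr funrpos_ge0.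
have fE (mu : {measure set T -> \bar R}) :
   mu.-integrable setT (EFin \o (f^\+)%R) -> mu.-integrable setT (EFin \o (f^\-)%R) ->
   (\int[mu]_x f x = \int[mu]_x (f^\+)%R x - \int[mu]_x (f^\-)%R x)%R.
  move=> i1 i2; rewrite -RintegralB//; apply: eq_Rintegral => x _.
  by rewrite -[in LHS](funrposBneg f).
rewrite fE; [|exact: double_series_integrable..].
have -> : (fun n => \sum_(k < n) \sum_(l < a k) \int[m k l]_x f x)%R =
    (partial_sum (f^\+)%R \- partial_sum (f^\-)%R)%R.
  apply/funext => n /=; rewrite /partial_sum -sumrB; apply: eq_bigr => k _.
  by rewrite -sumrB; apply: eq_bigr => l _; rewrite fE//; exact: summand_integrable.
by apply: cvgB; apply: ge0_double_series_cvg.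
Qed.

End SeriesOfMeasures.

Section SignedSeries.
Context disp (T : measurableType disp) (R : realType) (a : nat -> nat).
Variables mp mn : forall k, 'I_(a k) -> {measure set T -> \bar R}.
Arguments mp : clear implicits.
Arguments mn : clear implicits.

(** Finite total masses alone determine the charge; the integrand comes afterwards, so one charge
    serves every f that is summable against both families. *)
Lemma signed_series :
  (\sum_(k <oo) \sum_(l < a k) mp k l setT < +oo)%E ->
  (\sum_(k <oo) \sum_(l < a k) mn k l setT < +oo)%E ->
  exists mu : {charge set T -> \bar R}, forall f : T -> R,
    measurable_fun setT f ->
    (\sum_(k <oo) \sum_(l < a k) \int[mp k l]_x `|(f x)%:E| < +oo)%E ->
    (\sum_(k <oo) \sum_(l < a k) \int[mn k l]_x `|(f x)%:E| < +oo)%E ->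
    (Defs.total_variation mu).-integrable setT (EFin \o f) /\
    \sum_(k < n) \sum_(l < a k) (\int[mp k l]_x f x - \int[mn k l]_x f x)
      @[n --> \oo] --> signed_integral mu f.
Proof.
rewrite -(double_series_setT mp) -(double_series_setT mn) => fp fn.
have [mu muP] := charge_difference (finite_of fp) (finite_of fn).
exists mu => f mf sp sn.
have [ip cp] := double_series_integral mf sp.
have [i_n cn] := double_series_integral mf sn.
have [itv ->] := muP _ ip i_n; split => //.
rewrite [X in X @ _ --> _](_ : _ =
  (fun n => \sum_(k < n) \sum_(l < a k) \int[mp k l]_x f x) \-
  (fun n => \sum_(k < n) \sum_(l < a k) \int[mn k l]_x f x)); first exact: cvgB cp cn.
apply/funext => n /=; rewrite -sumrB; apply: eq_bigr => k _.
by rewrite -sumrB.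
Qed.

End SignedSeries.

(** Destructing the existential yields an opaque structured copy, known only through its equality
    with [m]. *)
Lemma sigma_finite_measureP disp (T : measurableType disp) (R : realType)
    (m : {measure set T -> \bar R}) : sigma_finite setT m ->
  exists m' : {sigma_finite_measure set T -> \bar R}, m' = m :> (set T -> \bar R).
Proof. by move=> mT; exists (sigma_finite_of mT). Qed.

Lemma finite_measureP disp (T : measurableType disp) (R : realType)
    (m : {measure set T -> \bar R}) : (m setT < +oo)%E ->
  exists m' : {finite_measure set T -> \bar R}, m' = m :> (set T -> \bar R).
Proof. by move=> mT; exists (finite_of mT). Qed.

(** * Gaussian integrals on euclidean space *)

Section LebesgueScaling.
Context {R : realType}.
Local Notation leb := (@lebesgue_measure R).

Lemma cons_rV_ord0 n (s : measurableTypeR R) (y : euclidean R n) :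
  (cons_rV (s, y) : 'rV[R]_n.+1) ord0 ord0 = s.
Proof.
have -> : (ord0 : 'I_n.+1) = lshift n (ord0 : 'I_1) :> 'I_(1 + n) by exact: val_inj.
by rewrite [LHS]row_mxEl mxE.
Qed.

Lemma cons_rV_lift n (s : measurableTypeR R) (y : euclidean R n) (i : 'I_n) :
  (cons_rV (s, y) : 'rV[R]_n.+1) ord0 (lift ord0 i) = (y : 'rV[R]_n) ord0 i.
Proof.
have -> : lift ord0 i = rshift 1 i :> 'I_(1 + n) by exact: val_inj.
by rewrite [LHS]row_mxEr.
Qed.

Definition cube n (M : R) : set (euclidean R n) :=
  [set x | forall i, - M <= (x : 'rV[R]_n) ord0 i <= M].

Arguments cube : clear implicits.

Lemma measurable_cube n M : measurable (cube n M).
Proof.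
rewrite (_ : cube n M = \bigcap_(i in [set: 'I_n])
    ((fun x : euclidean R n => x ord0 i : measurableTypeR R) @^-1` `[- M, M])).
  apply: fin_bigcap_measurable => // i _.
  by rewrite -[X in measurable X]setTI; apply: measurable_coord.
apply/seteqP; split => x h i; first by move=> _; rewrite /= in_itv/= h.
by have := h i I; rewrite /= in_itv.
Qed.

Lemma lebesgue_rV_cube n (M : R) : (0 <= M)%R ->
  lebesgue_rV n (cube n M) = ((M *+ 2) ^+ n)%:E.
Proof.
move=> M0; elim: n => [|n ih].
  rewrite /= /dirac/= indicE mem_set//; move=> i; by case: i.
rewrite /= /pushforward.
have -> : @cons_rV R n @^-1` cube n.+1 M = `[- M, M]%classic `*` cube n M.
  apply/seteqP; split => -[s y] /= h.
    split => [|i]; first by have := h ord0; rewrite cons_rV_ord0 in_itv.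
    by have := h (lift ord0 i); rewrite cons_rV_lift.
  case: h; rewrite in_itv/= => hs hy i.
  by case: (unliftP ord0 i) => [j|] ->; rewrite ?cons_rV_lift ?cons_rV_ord0.
rewrite product_measure2E//; last exact: measurable_cube.
transitivity (leb `[(- M)%R, M]%classic * lebesgue_rV n (cube n M))%E => //.
rewrite ih lebesgue_measure_itv/= lte_fin.
have [M1|] := ltP (- M) M; first by rewrite -EFinB -EFinM opprK exprS mulr2n.
move=> M2; have -> : M = 0 by lra.
by rewrite mul0e mul0rn expr0n.
Qed.

Lemma lebesgue_rV_sigma_finite n : sigma_finite setT (@lebesgue_rV R n).
Proof.
exists (fun k => cube n k%:R).
  apply/seteqP; split => // x _.
  pose b : R := \big[Num.max/0]_(i < n) `|(x : 'rV[R]_n) ord0 i|.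
  exists (Num.bound b) => // i.
  have bi : `|(x : 'rV[R]_n) ord0 i| <= b by exact: le_bigmax.
  rewrite -ler_norml; apply: (le_trans bi).
  exact/ltW/archi_boundP/(le_trans _ bi).
move=> k; split; first exact: measurable_cube.
by rewrite lebesgue_rV_cube// ltry.
Qed.

(** By uniqueness of Lebesgue measure: t times its image under x |-> t x gives ]a, b] the mass t
    (b/t - a/t). *)
Lemma lebesgue_scale1 (t : R) (f : R -> \bar R) : (0 < t)%R ->
  measurable_fun setT (f : measurableTypeR R -> \bar R) -> (forall x, 0 <= f x)%E ->
  (\int[leb]_x f (t * x)%R = (t^-1)%:E * \int[leb]_x f x)%E.
Proof.
move=> t0 mf f0.
have mt : measurable_fun setT (fun x : measurableTypeR R => (t * x : measurableTypeR R)).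
  exact: measurable_funM.
pose m := image_measure leb mt.
have -> : (\int[leb]_x f (t * x)%R = \int[m]_x f x)%E.
  by rewrite ge0_integral_pushforward//= => x _.
have E A : measurable A -> leb A = mscale (NngNum (ltW t0)) m A.
  apply: (@lebesgue_measure_unique _ (mscale (NngNum (ltW t0)) m)) => _ [[a b]] _ <-.
  transitivity (t%:E * leb ((fun x : R => (t * x)%R) @^-1` `]a, b]%classic))%E => //.
  rewrite (_ : _ @^-1` _ = `]a / t, b / t]%classic); last first.
    by apply/seteqP; split => x /=; rewrite !in_itv/= ltr_pdivrMr// ler_pdivlMr// ![x * t]mulrC.
  rewrite !lebesgue_measure_itv/= !lte_fin ltr_pM2r ?invr_gt0//.
  case: ifPn => _; last by rewrite mule0.
  by rewrite -!EFinB -EFinM -mulrBl mulrC divfK// gt_eqF.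
rewrite [in RHS](eq_measure_integral (mscale (NngNum (ltW t0)) m)) => [|A mA _]; last exact: E.
rewrite ge0_integral_mscale//= muleA -EFinM mulVf ?gt_eqF//.
by rewrite mul1e.
Qed.

(** The product in the recursive definition of [lebesgue_rV] is formed before sigma-finiteness of
    the lower-dimensional factor is known. With that fact available it is identified, on rectangles,
    with the product to which Tonelli applies. *)
Lemma ge0_integral_lebesgue_rVS n (f : euclidean R n.+1 -> \bar R) :
  measurable_fun setT f -> (forall x, 0 <= f x)%E ->
  (\int[lebesgue_rV n.+1]_x f x =
   \int[lebesgue_rV n]_y \int[leb]_s f (cons_rV (s, y)))%E.
Proof.
move=> mf f0.
have mfc : measurable_fun setT (f \o @cons_rV R n).
  exact: (measurableT_comp mf (@measurable_cons_rV R n)).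
rewrite [LHS]ge0_integral_pushforward//; last exact: measurable_cons_rV.
rewrite preimage_setT.
pose L := sigma_finite_of (lebesgue_rV_sigma_finite n).
transitivity (\int[leb \x L]_z (f \o @cons_rV R n) z)%E.
  apply: eq_measure_integral => //= A mA _; symmetry.
  apply: (@product_measure_unique _ _ _ _ _ _ _ (leb \x^ L)%E) => // B C mB mC/=.
  by rewrite product_measure2E.
by rewrite fubini_tonelli2// => z /=.
Qed.

(** Each coordinate contributes one factor t^-1, by induction on the dimension. *)
Lemma lebesgue_scale n (t : R) (f : euclidean R n -> \bar R) : (0 < t)%R ->
  measurable_fun setT f -> (forall x, 0 <= f x)%E ->
  (\int[lebesgue_rV n]_x f (t *: (x : 'rV[R]_n))%R =
   (t ^- n)%:E * \int[lebesgue_rV n]_x f x)%E.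
Proof.
move=> t0; elim: n f => [|n ih] f mf f0.
  rewrite expr0 invr1 mul1e; congr integral; apply/funext => x.
  by congr f; apply/rowP => -[].
have mt k : measurable_fun setT (fun x : euclidean R k => (t *: (x : 'rV[R]_k) : euclidean R k)).
  apply: measurable_euclidean => i; under eq_fun do rewrite mxE.
  by apply: measurable_funM => //; exact: measurable_coord.
have mc (y : euclidean R n) : measurable_fun setT
    (fun s : measurableTypeR R => (cons_rV (s, y) : euclidean R n.+1)).
  exact: (measurableT_comp (@measurable_cons_rV R n) (pair2_measurable y)).
pose L := sigma_finite_of (lebesgue_rV_sigma_finite n).
pose F y := (\int[leb]_s f (cons_rV (s, y)))%E.
have mF : measurable_fun setT F.
  exact: (@measurable_fun_fubini_tonelli_G _ _ _ _ _ leb (f \o @cons_rV R n)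
    (measurableT_comp mf (@measurable_cons_rV R n)) (fun=> f0 _)).
have F0 y : (0 <= F y)%E by exact: integral_ge0.
rewrite !ge0_integral_lebesgue_rVS//; last exact: measurableT_comp mf (mt _).
transitivity (\int[lebesgue_rV n]_y ((t^-1)%:E * F (t *: (y : 'rV[R]_n))))%E.
  apply: eq_integral => y _; rewrite -lebesgue_scale1//; last first.
    exact: measurableT_comp mf (mc _).
  apply: eq_integral => s _; congr f; apply/rowP => i; rewrite mxE.
  by case: (unliftP ord0 i) => [j|] ->; rewrite ?cons_rV_lift ?cons_rV_ord0 ?mxE.
rewrite ge0_integralZl_EFin//; last 2 first.
- exact: measurableT_comp mF (mt _).
- by rewrite invr_ge0 ltW.
by rewrite ih// muleA -EFinM exprS invfM.
Qed.

End LebesgueScaling.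

Section GaussianMoments.
Context {R : realType}.
Local Notation leb := (@lebesgue_measure R).

(** Fundamental theorem of calculus on [-n, n], then dominated convergence with |h'| itself as the
    bound. *)
Lemma integral_derive_eq0 (h h' : R -> R) :
  (forall x : R, is_derive x (1 : R) h (h' x)) -> continuous h' ->
  leb.-integrable setT (EFin \o h') ->
  h n%:R - h (- n%:R) @[n --> \oo] --> 0 ->
  \int[leb]_x h' x = 0.
Proof.
move=> dh ch ih hl.
have mh : measurable_fun setT h' by exact: continuous_measurable_fun.
pose I n : set R := `[- n%:R, n%:R]%classic.
pose f_ (n : nat) (x : R) : \bar R := ((EFin \o h') \_ (I n)) x.
have mI n : measurable (I n : set (measurableTypeR R)) by exact: measurable_itv.
(* The case n = 0 is separate because the fundamental theorem needs a nondegenerate interval. *)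
have Ih n : (\int[leb]_x f_ n x = (h n%:R - h (- n%:R))%:E)%E.
  rewrite -integral_mkcond; case: n => [|n].
    rewrite /I oppr0 subrr set_itv1 integral_set1//.
  rewrite (@continuous_FTC2 _ h' h)//.
  - by rewrite -subr_gt0 opprK -mulr2n pmulrn_lgt0.
  - exact: continuous_subspaceT.
  - split => [x _||].
    + exact: (@ex_derive _ _ _ _ _ _ _ (dh x)).
    + apply: cvg_at_right_filter; apply: differentiable_continuous.
      exact/derivable1_diffP/(@ex_derive _ _ _ _ _ _ _ (dh _)).
    + apply: cvg_at_left_filter; apply: differentiable_continuous.
      exact/derivable1_diffP/(@ex_derive _ _ _ _ _ _ _ (dh _)).
  - by move=> x _; rewrite derive1E; exact: (@derive_val _ _ _ _ _ _ _ (dh x)).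
have [|||||_ _ dc] := @dominated_convergence _ _ _ leb setT measurableT f_ (EFin \o h')
    (EFin \o (fun x => `|h' x|)).
- by move=> n; apply/(measurable_restrictT _ (mI n))/measurable_EFinP/measurable_funTS.
- exact/measurable_EFinP.
- apply: aeW => x _; apply: cvg_near_cst; near=> n.
  rewrite /f_ patchE mem_set// /I /= in_itv/= -ler_norml.
  near: n; exact: nbhs_infty_ger.
- exact: integrable_norm.
- apply: aeW => x n _; rewrite /f_ patchE.
  by case: ifPn => //= _; rewrite normr0 lee_fin.
move: dc; under eq_fun do rewrite Ih.
move=> dc; have : (\int[leb]_x (h' x)%:E = 0)%E.
  rewrite -(cvg_lim _ dc)//; apply/cvg_lim => //.
  by apply: cvg_EFin; [exact: nearW|exact: hl].
by rewrite /Rintegral => ->.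
Unshelve. all: by end_near. Qed.

(** exp u is the (n+1)-st power of exp (u/(n+1)), which is at least 1 + u/(n+1). *)
Lemma expR_ge_power (u : R) n : 0 <= u -> (u / n.+1%:R) ^+ n.+1 <= expR u.
Proof.
move=> u0; rewrite -[in leRHS](@divfK _ n.+1%:R _ u) ?pnatr_eq0//.
rewrite [X in expR X]mulrC expRM_natl lerXn2r// ?nnegrE ?divr_ge0 ?expR_ge0//.
by rewrite (le_trans _ (expR_ge1Dx _))// lerDr.
Qed.

(** Half of the exponent is spent on absorbing the power; the other half remains as exp (-t^2/2),
    still integrable. *)
Lemma gauss_moment_bound n : exists C : R, 0 <= C /\
  forall t, `|t ^+ n * gauss_fun t| <= C * gauss_fun (Num.sqrt 2^-1 * t).
Proof.
(* With u = t^2/2 one has |t^n| <= 1 + (t^2)^(n+1) and t^2 = 2(n+1) (u/(n+1)). Then 1 <= exp u and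
   [expR_ge_power] bound the two terms by multiples of exp u. *)
exists (1 + (n.+1%:R *+ 2) ^+ n.+1); split.
  by rewrite addr_ge0// exprn_ge0// mulrn_wge0.
move=> t; rewrite normrM (ger0_norm (gauss_fun_ge0 _)).
have -> : gauss_fun t = gauss_fun (Num.sqrt 2^-1 * t) * gauss_fun (Num.sqrt 2^-1 * t).
  rewrite /gauss_fun -expRD exprMn sqr_sqrtr ?invr_ge0//; congr expR; lra.
rewrite mulrA ler_wpM2r ?gauss_fun_ge0//.
rewrite -ler_pdivlMr ?expR_gt0// /gauss_fun expRN invrK exprMn sqr_sqrtr ?invr_ge0//.
set u := 2^-1 * t ^+ 2.
have u0 : 0 <= u by rewrite mulr_ge0// ?invr_ge0// sqr_ge0.
have h1 : `|t ^+ n| <= 1 + (t ^+ 2) ^+ n.+1.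
  rewrite normrX; have [t1|t1] := leP `|t| 1.
    by rewrite (@le_trans _ _ 1) ?exprn_ile1// lerDl exprn_ge0// sqr_ge0.
  rewrite -(real_normK (num_real t)) -exprM (@le_trans _ _ (`|t| ^+ (2 * n.+1)))//.
    by rewrite ler_weXn2l 1?ltW// (leq_trans (leqnSn _))// leq_pmull.
  by rewrite lerDr.
apply: (le_trans h1); rewrite mulrDl mul1r lerD//.
  by rewrite -expR0 ler_expR.
have -> : t ^+ 2 = (n.+1%:R *+ 2) * (u / n.+1%:R).
  have : n.+1%:R != 0 :> R by rewrite pnatr_eq0.
  by move: (n.+1%:R : R) => N N0; rewrite /u mulr2n; field.
by rewrite exprMn ler_wpM2l ?exprn_ge0 ?mulrn_wge0// expR_ge_power.
Qed.

Lemma measurable_gauss_moment n :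
  measurable_fun setT (fun t : measurableTypeR R => t ^+ n * gauss_fun t : measurableTypeR R).
Proof.
apply: measurable_funM; first exact: measurable_funX.
exact: measurable_gauss_fun.
Qed.

Lemma gauss_moment_integrable n :
  leb.-integrable setT (fun t => (t ^+ n * gauss_fun t)%:E).
Proof.
have [C [C0 le_C]] := gauss_moment_bound n.
have g0 : (forall x : R, 0 <= (EFin \o gauss_fun) x)%E by move=> x; rewrite lee_fin gauss_fun_ge0.
have mg : measurable_fun setT ((EFin \o gauss_fun) : measurableTypeR R -> \bar R).
  by apply/measurable_EFinP; exact: measurable_gauss_fun.
have s0 : 0 < Num.sqrt 2^-1 :> R by rewrite sqrtr_gt0 invr_gt0.
apply/integrableP; split.
  by apply/measurable_EFinP; exact: measurable_gauss_moment.
apply: (@le_lt_trans _ _ (\int[leb]_t (C%:E * (EFin \o gauss_fun) (Num.sqrt 2^-1 * t)%R))%E).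
  apply: ge0_le_integral => //.
  - apply: measurableT_comp => //; apply/measurable_EFinP.
    exact: measurable_gauss_moment.
  - apply: measurable_funeM; apply: (measurableT_comp mg); exact: measurable_funM.
  - by move=> t _; rewrite -EFinM lee_fin.
rewrite ge0_integralZl_EFin//; last first.
  by apply: (measurableT_comp mg); exact: measurable_funM.
by rewrite lebesgue_scale1// integralT_gauss -!EFinM ltry.
Qed.

Definition gauss_moment n : R := \int[leb]_t (t ^+ n * gauss_fun t).

(** The derivative of t^n exp (-t^2) integrates to 0. For n = 0 the truncated [n.-1] carries the
    coefficient 0, and the statement says that the first moment vanishes. *)
Lemma gauss_momentS n : gauss_moment n.+1 = n%:R / 2 * gauss_moment n.-1.
Proof.
pose h (t : R) := t ^+ n * gauss_fun t.
pose h' (t : R) := n%:R * (t ^+ n.-1 * gauss_fun t) - 2 * (t ^+ n.+1 * gauss_fun t).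
have dh (t : R) : is_derive t (1 : R) h (h' t).
  have dX m : is_derive t (1 : R) ((id : R -> R) ^+ m) _ := is_deriveX m (is_derive_id t 1).
  have de := is_derive1_comp (is_derive_expR _) (is_deriveN (dX 2%N)).
  have hE : h = (id : R -> R) ^+ n * (expR \o - ((id : R -> R) ^+ 2)).
    by apply/funext => x; rewrite /h /gauss_fun !fctE.
  rewrite hE; apply: is_derive_eq (is_deriveM (dX n) de) _.
  have -> : h' t = t ^+ n * (expR (- t ^+ 2) * - (2 * t ^+ 1 * 1)) +
      expR (- t ^+ 2) * (n%:R * t ^+ n.-1 * 1).
    by rewrite /h' /gauss_fun (exprS t n) expr1; ring.
  by rewrite !fctE.
have ch : continuous h'.
  have cm m c : continuous (fun t : R => c * (t ^+ m * gauss_fun t)).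
    move=> x; apply: cvgM; first exact: cvg_cst.
    by apply: cvgM; [exact: exprn_continuous|exact: continuous_gauss_fun].
  by move=> x; apply: cvgB; exact: cm.
have ih m c : leb.-integrable setT (EFin \o (fun t => c * (t ^+ m * gauss_fun t))).
  exact: integrableZl (gauss_moment_integrable m).
have : \int[leb]_x h' x = 0.
  apply: (integral_derive_eq0 dh ch).
    by rewrite /h'; apply: integrableB (ih _ _) (ih _ _).
  (* The bound for the next power gives |t| |h t| <= C, so the boundary terms are at most 2C/N. *)
  have [C [C0 bC]] := gauss_moment_bound n.+1.
  have hb (t : R) : `|t| * `|h t| <= C.
    rewrite -normrM /h mulrA -exprS (le_trans (bC t))// ler_piMr// gauss_fun_le1//.
  apply/cvgr0Pnorm_lt => e e0; near=> N.
  have N0 : 0 < N%:R :> R by near: N; exact: nbhs_infty_gtr.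
  have NC : (C + C) / e < N%:R by near: N; exact: nbhs_infty_gtr.
  have h1 := hb N%:R; have h2 := hb (- N%:R).
  rewrite normrN in h2; rewrite (gtr0_norm N0) in h1 h2.
  rewrite (le_lt_trans (ler_normB _ _))// -(ltr_pM2l N0) mulrDr.
  by rewrite (le_lt_trans (lerD h1 h2))// -ltr_pdivrMr.
rewrite RintegralB// ?RintegralZl//; try exact: gauss_moment_integrable.
rewrite -!/(gauss_moment _) => /eqP; rewrite subr_eq0 => /eqP e.
by apply: (mulfI (_ : (2 : R) != 0)) => //; rewrite -e; field.
Unshelve. all: by end_near. Qed.

End GaussianMoments.

Section GaussianProduct.
Context {R : realType}.
Local Notation leb := (@lebesgue_measure R).

Lemma lebesgue_rVSE n (f : euclidean R n.+1 -> \bar R) :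
  let L := sigma_finite_of (@lebesgue_rV_sigma_finite R n) in
  (\int[image_measure (leb \x L)%E (@measurable_cons_rV R n)]_x f x =
  \int[lebesgue_rV n.+1]_x f x)%E.
Proof.
move=> L; apply: eq_measure_integral => /= A mA _.
apply: (@product_measure_unique _ _ _ _ _ _ _ (leb \x^ L)%E) => [B C mB mC|].
  by rewrite /= product_measure2E.
by rewrite -[X in measurable X]setTI; apply: measurable_cons_rV.
Qed.

Lemma integral_lebesgue_rVS n (f : euclidean R n.+1 -> \bar R) :
  (lebesgue_rV n.+1).-integrable setT f ->
  (\int[lebesgue_rV n.+1]_x f x =
   \int[lebesgue_rV n]_y \int[leb]_s f (cons_rV (s, y)))%E.
Proof.
move=> /integrableP[mf fi].
have mc := @measurable_cons_rV R n.
pose L := sigma_finite_of (@lebesgue_rV_sigma_finite R n).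
have fci : (leb \x L)%E.-integrable setT (f \o @cons_rV R n).
  apply/integrableP; split; first exact: measurableT_comp mf mc.
  move: fi; rewrite -lebesgue_rVSE ge0_integral_pushforward//.
  exact: measurableT_comp.
rewrite -lebesgue_rVSE [LHS]integral_pushforward// preimage_setT.
by rewrite -(integral21_prod_meas1 fci).
Qed.

(** The product form suits recursion on the coordinates; [gauss_weightE] gives the radial form used
    on cones. *)
Definition gauss_weight n (x : euclidean R n) : R := \prod_(i < n) gauss_fun (x ord0 i).

Lemma measurable_gauss_weight n : measurable_fun setT (@gauss_weight n).
Proof.
rewrite /gauss_weight; apply: measurable_prod => i _.
apply: (measurableT_comp measurable_gauss_fun); exact: measurable_coord.
Qed.

Lemma gauss_weightE n (x : euclidean R n) : gauss_weight x = expR (- enorm x ^+ 2).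
Proof.
rewrite /gauss_weight /enorm sqr_sqrtr ?sumr_ge0// => [|i _]; last exact: sqr_ge0.
by rewrite -sumrN expR_sum.
Qed.

Definition monomial_gauss n (m : 'I_n -> nat) (x : euclidean R n) : R :=
  \prod_(i < n) (x ord0 i ^+ m i) * gauss_weight x.

Lemma measurable_monomial_gauss n (m : 'I_n -> nat) :
  measurable_fun setT (monomial_gauss m).
Proof.
apply: measurable_funM; last exact: measurable_gauss_weight.
by apply: measurable_prod => i _; apply: measurable_funX; exact: measurable_coord.
Qed.

Lemma monomial_gauss_cons n (m : 'I_n.+1 -> nat) (s : R) (y : euclidean R n) :
  monomial_gauss m (cons_rV (s, y)) =
  (s ^+ m ord0 * gauss_fun s) * monomial_gauss (fun i => m (lift ord0 i)) y.
Proof.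
rewrite /monomial_gauss /gauss_weight !big_ord_recl cons_rV_ord0.
under eq_bigr do rewrite cons_rV_lift.
under [X in _ * (_ * X)]eq_bigr do rewrite cons_rV_lift.
by rewrite mulrACA.
Qed.

(** Integrability and value are proved in one induction, since Fubini for a signed integrand
    consumes the first to produce the second. *)
Lemma integral_monomial_gauss n (m : 'I_n -> nat) :
  (lebesgue_rV n).-integrable setT (EFin \o monomial_gauss m) /\
  \int[lebesgue_rV n]_x monomial_gauss m x = \prod_(i < n) gauss_moment (m i).
Proof.
elim: n m => [|n ih] m.
  have c1 : EFin \o monomial_gauss m = cst 1%E.
    by apply/funext => x; rewrite /= /monomial_gauss /gauss_weight !big_ord0 mulr1.
  rewrite c1; split.
    apply/integrableP; split => //.
    rewrite (eq_integral (cst 1%E)) => [|x _]; last by rewrite /= normr1.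
    by rewrite integral_cst//= mul1e /dirac/= indicE in_setT ltry.
  rewrite big_ord0.
  transitivity (fine (\int[lebesgue_rV 0]_x (cst 1 x : \bar R))%E).
    by congr (fine (integral _ _ _)); exact: c1.
  by rewrite integral_cst// mul1e /= /dirac indicE in_setT.
have [ii iE] := ih (fun i => m (lift ord0 i)).
set m' := fun i => m (lift ord0 i) in ii iE.
have ig := gauss_moment_integrable (m ord0) (R := R).
have mm k (q : 'I_k -> nat) : measurable_fun setT (EFin \o @monomial_gauss k q).
  by apply/measurable_EFinP; exact: measurable_monomial_gauss.
have mg : measurable_fun setT (fun t : measurableTypeR R => (t ^+ m ord0 * gauss_fun t)%:E).
  by case/integrableP: ig.
have ifm : (lebesgue_rV n.+1).-integrable setT (EFin \o monomial_gauss m).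
  apply/integrableP; split => //.
  rewrite ge0_integral_lebesgue_rVS//; last exact: measurableT_comp.
  pose I := (\int[leb]_s `|(s ^+ m ord0 * gauss_fun s)%:E|)%E.
  have IE (y : euclidean R n) :
      (\int[leb]_s `|(EFin \o monomial_gauss m) (cons_rV (s, y))| =
       `|(EFin \o monomial_gauss m') y| * I)%E.
    rewrite -ge0_integralZl//; last exact: measurableT_comp.
    by apply: eq_integral => s _; rewrite /= monomial_gauss_cons normrM EFinM muleC.
  under eq_integral do rewrite IE.
  rewrite ge0_integralZr//; last 2 first.
  - exact: measurableT_comp.
  - exact: integral_ge0.
  apply: lte_mul_pinfty; first exact: integral_ge0.
    rewrite ge0_fin_numE; last exact: integral_ge0.
    by case/integrableP: ii.
  by case/integrableP: ig.
split => //; rewrite /Rintegral integral_lebesgue_rVS//.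
have IE (y : euclidean R n) :
    (\int[leb]_s (EFin \o monomial_gauss m) (cons_rV (s, y)) =
     (gauss_moment (m ord0))%:E * (EFin \o monomial_gauss m') y)%E.
  transitivity (\int[leb]_s ((s ^+ m ord0 * gauss_fun s)%:E * (monomial_gauss m' y)%:E))%E.
    by apply: eq_integral => s _; rewrite /= monomial_gauss_cons EFinM.
  rewrite integralZr// /gauss_moment /Rintegral fineK//.
  exact: (integrable_fin_num _ ig).
under eq_integral do rewrite IE.
rewrite integralZl// fineM//; last exact: (integrable_fin_num _ ii).
by rewrite big_ord_recl -iE.
Qed.

End GaussianProduct.

(** * Harmonic polynomials under the Gaussian weight *)

Section HarmonicPolynomials.
Context {R : realType} {d : nat}.
Implicit Types (p q : mpoly d R) (m : multinom d).
Local Notation homog k := (ishomog1 k mdeg).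
Local Notation X_ i := (mpolyX R (mnm1 i)).

Lemma euler_identity k p : p \is homog k ->
  \sum_(i < d) X_ i * mderiv i p = k%:R *: p.
Proof.
move=> /dhomogP hp.
have pE : p = \sum_(m <- msupp p) mcoeff m p *: mpolyX R m := mpolyE p.
rewrite {2}pE scaler_sumr.
under eq_bigr => i _ do rewrite {1}pE linear_sum mulr_sumr.
rewrite exchange_big /= big_seq [in RHS]big_seq; apply: eq_bigr => m mp.
have -> : k = mdeg m by exact/esym/hp.
rewrite mdegE natr_sum scaler_suml; apply: eq_bigr => i _.
rewrite mderivZ -scalerAr mderivX -scalerAr !scalerA mulrC.
(* If x_i does not occur in the monomial, the truncated exponent is wrong but its coefficient is
   0. *)
have [mi|mi] := posnP (m i); first by rewrite mi !mul0r !scale0r.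
rewrite -mpolyXD addmC submK//; apply/mnm_lepP => j; rewrite mnm1E.
by case: eqP => // <-.
Qed.

Lemma mderiv_homog k i p : p \is homog k -> mderiv i p \is homog k.-1.
Proof.
move=> /dhomogP hp; rewrite [p]mpolyE linear_sum/= big_seq.
apply: rpred_sum => m mp; rewrite mderivZ rpredZ// mderivX.
have [->|mi] := posnP (m i); first by rewrite scale0r rpred0.
have -> : k = mdeg m by exact/esym/hp.
rewrite rpredZ// dhomogX; apply/eqP; change (mdeg (mnm_sub m (mnm1 i)) = (mdeg m).-1).
rewrite -[in RHS](@submK _ (mnm1 i) m) ?mdegD ?mdeg1 ?addn1//.
by apply/mnm_lepP => j; rewrite mnm1E; case: eqP => // <-.
Qed.

(* The inductive step moves a variable from the monomial onto p through the
   integration by parts rule; the base case is Euler's identity. *)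
Lemma harmonic_orthogonal (L : mpoly d R -> R) (c : R) :
  (forall p q, L (p + q) = L p + L q) ->
  (forall a p, L (a *: p) = a * L p) ->
  (forall i p, L (X_ i * p) = c * L (mderiv i p)) ->
  forall m k p, p \is homog k -> \sum_(i < d) mderiv i (mderiv i p) = 0 ->
    (mdeg m < k)%N -> L (mpolyX R m * p) = 0.
Proof.
move=> LD LZ LX m.
have L0 : L 0 = 0 by rewrite -(scale0r 0) LZ mul0r.
have Lsum (F : 'I_d -> mpoly d R) : L (\sum_(i < d) F i) = \sum_(i < d) L (F i).
  by apply: (big_morph L LD L0).
have [n] := ubnP (mdeg m); elim: n m => // n ih m mn k p hp Dp mk.
have [/eqP m0|m0] := posnP (mdeg m).
  move: m0 mk; rewrite mdeg_eq0 => /eqP ->; rewrite mdeg0 mpolyX0 mul1r => k0.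
  have := congr1 L (euler_identity hp); rewrite LZ Lsum.
  under eq_bigr do rewrite LX.
  rewrite -mulr_sumr -Lsum Dp L0 mulr0 => /esym/eqP.
  by rewrite mulf_eq0 pnatr_eq0 (gtn_eqF k0)/= => /eqP.
have [i mi] : exists i, (0 < m i)%N.
  apply/existsP; apply: contraTT m0; rewrite negb_exists => /forallP h.
  by rewrite -leqNgt leqn0 mdegE big1// => i _; apply/eqP; rewrite -leqn0 leqNgt.
have mE : m = mnm_add (mnm1 i) (mnm_sub m (mnm1 i)).
  rewrite addmC submK//; apply/mnm_lepP => j; rewrite mnm1E.
  by case: eqP => // <-.
set m' := (mnm_sub m (mnm1 i)) in mE.
have dm : mdeg m = (mdeg m').+1 by rewrite mE mdegD mdeg1.
(* Product rule. Where the derivative falls on p, [mderiv i p] is harmonic of degree k-1 and meets a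
   monomial with one variable less; where it falls on the monomial, the degree of the latter drops
   and p is unchanged. *)
rewrite mE mpolyXD -mulrA LX mderivM LD.
rewrite (ih m' _ k.-1 (mderiv i p)); last 4 first.
- by rewrite -ltnS -dm.
- exact: mderiv_homog.
- under eq_bigr => j _ do rewrite (mderiv_comm i j) (mderiv_comm i j).
  by rewrite -linear_sum Dp linear0.
- by move: mk; rewrite dm; case: (k).
rewrite addr0 mderivX -scalerAl LZ (ih _ _ k p hp Dp) ?mulr0//.
- by rewrite (leq_ltn_trans (mdegB _ _))// -ltnS -dm.
- by rewrite (leq_ltn_trans (mdegB _ _))// (leq_ltn_trans _ mk)// dm leqnSn.
Qed.

End HarmonicPolynomials.

Section GaussianFunctional.
Context {R : realType} {d : nat}.
Implicit Types (p q : mpoly d R) (m : multinom d).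
Local Notation lam := (@lebesgue_rV R d).

Lemma pevalE p (x : euclidean R d) :
  peval p x = \sum_(m <- msupp p) mcoeff m p * \prod_(i < d) x ord0 i ^+ m i.
Proof. exact: mevalE. Qed.

Lemma measurable_peval p : measurable_fun setT (peval p : euclidean R d -> R).
Proof.
rewrite (_ : peval p = fun x : euclidean R d =>
    \sum_(m <- msupp p) mcoeff m p * \prod_(i < d) x ord0 i ^+ m i); last first.
  by apply/funext => x; rewrite pevalE.
apply: measurable_sum => m; apply: measurable_funM => //.
by apply: measurable_prod => i _; apply: measurable_funX; exact: measurable_coord.
Qed.

Lemma integrable_peval_gauss p :
  lam.-integrable setT (fun x => (peval p x * gauss_weight x)%:E).
Proof.
rewrite (_ : (fun x => _) = (fun x => \sum_(m <- msupp p)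
    (mcoeff m p)%:E * (monomial_gauss m x)%:E)%E).
  apply: integrable_sum => // m _; apply: integrableZl => //.
  exact: (integral_monomial_gauss m).1.
apply/funext => x; rewrite pevalE mulr_suml -sumEFin; apply: eq_bigr => m _.
by rewrite -EFinM mulrA.
Qed.

Definition gauss_functional p : R := \int[lam]_x (peval p x * gauss_weight x).

Lemma gauss_functionalD p q :
  gauss_functional (p + q) = gauss_functional p + gauss_functional q.
Proof.
rewrite /gauss_functional -RintegralD//; try exact: integrable_peval_gauss.
by apply: eq_Rintegral => x _; rewrite /peval mevalD mulrDl.
Qed.

Lemma gauss_functionalZ a p : gauss_functional (a *: p) = a * gauss_functional p.
Proof.
rewrite /gauss_functional -RintegralZl//; last exact: integrable_peval_gauss.
by apply: eq_Rintegral => x _; rewrite /peval mevalZ mulrA.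
Qed.

Lemma gauss_functionalX m :
  gauss_functional (mpolyX R m) = \prod_(i < d) gauss_moment (m i).
Proof.
rewrite -(integral_monomial_gauss m).2; apply: eq_Rintegral => x _.
by rewrite /peval mevalX.
Qed.

Lemma gauss_functional_sum (T : Type) (r : seq T) (F : T -> mpoly d R) :
  gauss_functional (\sum_(i <- r) F i) = \sum_(i <- r) gauss_functional (F i).
Proof.
apply: (big_morph _ gauss_functionalD).
by rewrite -(scale0r 0) gauss_functionalZ mul0r.
Qed.

(** Integration by parts against exp (-|x|^2). On a monomial only the i-th factor of the product of
    moments changes, and [gauss_momentS] is the required relation. *)
Lemma gauss_functional_mderiv i p :
  gauss_functional (mpolyX R (mnm1 i) * p) = 2^-1 * gauss_functional (mderiv i p).
Proof.
rewrite [p]mpolyE linear_sum/= mulr_sumr !gauss_functional_sum mulr_sumr.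
apply: eq_bigr => m _; rewrite -scalerAr mderivZ !gauss_functionalZ mulrCA; congr (_ * _).
rewrite mderivX gauss_functionalZ -mpolyXD !gauss_functionalX.
rewrite (bigD1 i)//= [in RHS](bigD1 i)//= mnmDE mnmBE mnm1E eqxx add1n subn1.
rewrite gauss_momentS !mulrA; congr (_ * _); first by rewrite [_ / 2]mulrC.
by apply: eq_bigr => j ji; rewrite mnmDE mnmBE mnm1E eq_sym (negbTE ji) add0n subn0.
Qed.

End GaussianFunctional.

(** * Polar decomposition of Lebesgue measure *)

(** Homogeneity determines radial measures on the rays []-oo, t]]; these are stable under
    intersection, so uniqueness of measures applies once they generate. *)
Lemma closed_rays_generate (R : realType) :
  (R.-ocitv.-measurable).-sigma.-measurable =
  <<s [set A : set R | exists x, A = `]-oo, x]%classic] >>.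
Proof.
rewrite RGenOInfty.measurableE; set G := [set _ | _].
apply/seteqP; split; apply: smallest_sub => //; try exact: smallest_sigma_algebra.
  move=> _ [x ->].
  have : (G.-sigma).-measurable (`]-oo, x]%classic : set (g_sigma_algebraType G)).
    by apply: sub_sigma_algebra; exists x.
  move=> /measurableC; congr (<<s G >> _).
  by rewrite setCitvl.
move=> _ [x ->].
have : ((@RGenOInfty.G R).-sigma).-measurable (`]x, +oo[%classic : set (g_sigma_algebraType (@RGenOInfty.G R))).
  by apply: sub_sigma_algebra; exists x.
by move=> /measurableC; congr (<<s _ >> _); rewrite setCitvr.
Qed.

Section Cones.
Context {R : realType} {d : nat}.
Local Notation lam := (@lebesgue_rV R d).
Implicit Types (x : euclidean R d) (A : set (euclidean R d)).

Lemma enorm_ge0 x : 0 <= enorm x. Proof. exact: sqrtr_ge0. Qed.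

Lemma enormZ (t : R) x : 0 <= t -> enorm (t *: (x : 'rV[R]_d) : euclidean R d) = t * enorm x.
Proof.
move=> t0; rewrite /enorm; under eq_bigr do rewrite mxE exprMn.
by rewrite -mulr_sumr sqrtrM ?sqr_ge0// sqrtr_sqr ger0_norm.
Qed.

Lemma coord_le_enorm x i : `|x ord0 i| <= enorm x.
Proof.
rewrite -sqrtr_sqr ler_wsqrtr// (bigD1 i)//= lerDl.
by apply: sumr_ge0 => j _; exact: sqr_ge0.
Qed.

Lemma enorm_eq0 x : enorm x = 0 -> x = (0 : 'rV[R]_d).
Proof.
move=> x0; apply/rowP => i; rewrite mxE; apply/eqP.
by rewrite -normr_eq0 eq_le normr_ge0 andbT -x0 coord_le_enorm.
Qed.

Lemma directionZ (t : R) x : 0 < t ->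
  direction (t *: (x : 'rV[R]_d) : euclidean R d) = direction x.
Proof.
move=> t0; rewrite /direction enormZ ?ltW// scalerA invfM mulrAC mulVf ?mul1r//.
exact: lt0r_neq0.
Qed.

Lemma directionK x : enorm x *: (direction x : 'rV[R]_d) = x.
Proof.
rewrite /direction scalerA; have [x0|x0] := eqVneq (enorm x) 0.
  by rewrite x0 mul0r scale0r -(enorm_eq0 x0).
by rewrite divff// scale1r.
Qed.

Lemma enorm_direction x : 0 < enorm x -> enorm (direction x) = 1.
Proof.
by move=> x0; rewrite /direction enormZ ?invr_ge0 ?ltW// mulVf// gt_eqF.
Qed.

(** The origin is left out because [direction] has only a default value there, namely 0. *)
Definition cone A : set (euclidean R d) := [set x | 0 < enorm x] `&` @direction R d @^-1` A.

Lemma measurable_cone A : measurable A -> measurable (cone A).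
Proof.
move=> mA; apply: measurableI.
  rewrite (_ : [set _ | _] = @enorm R d @^-1` `]0, +oo[).
    by rewrite -[X in measurable X]setTI; exact: measurable_enorm.
  by apply/seteqP; split => x /=; rewrite in_itv/= andbT.
by rewrite -[X in measurable X]setTI; exact: measurable_direction.
Qed.

Lemma punctured_ball_lty : (lam (@punctured_ball R d) < +oo)%E.
Proof.
have h : (lam (@punctured_ball R d) <= lam (@cube R d 1))%E.
  apply: le_measure; rewrite ?inE; [exact: measurable_punctured_ball|exact: measurable_cube|].
  move=> x /= /andP[_ x1] i; rewrite -ler_norml.
  exact: le_trans (coord_le_enorm _ _) x1.
by apply: (le_lt_trans h); rewrite lebesgue_rV_cube// ltry.
Qed.

Definition radial_measure A (mA : measurable A) : {measure set (measurableTypeR R) -> \bar R} :=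
  image_measure (mrestr lam (measurable_cone mA)) (@measurable_enorm R d).

(** Dilation by t preserves the cone and maps its part of norm at most 1 onto its part of norm at
    most t. *)
Lemma radial_measure_ray A (mA : measurable A) (t : R) : 0 < t ->
  (radial_measure mA `]-oo, t]%classic = (t ^+ d)%:E * radial_measure mA `]-oo, 1%R]%classic)%E.
Proof.
move=> t0; pose S (u : R) : set (euclidean R d) := @enorm R d @^-1` `]-oo, u] `&` cone A.
have mS u : measurable (S u).
  apply: measurableI; last exact: measurable_cone.
  by rewrite -[X in measurable X]setTI; exact: measurable_enorm.
transitivity ((t ^+ d)%:E * lam (S 1%R))%E => //.
transitivity (lam (S t)) => //.
have S1 : (lam (S 1%R) = (t ^- d)%:E * lam (S t))%E.
  transitivity (\int[lam]_x (\1_(S t) (t *: (x : 'rV[R]_d)))%:E)%E.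
    transitivity (\int[lam]_x (\1_(S 1%R) x)%:E)%E; first by rewrite integral_indic// setIT.
    apply: eq_integral => x _.
    congr EFin; rewrite !indicE; congr (nat_of_bool _)%:R.
    by apply/idP/idP; rewrite !inE /S /cone /= !in_itv/= (enormZ _ (ltW t0))
      (directionZ _ t0) pmulr_rgt0// ger_pMr.
  rewrite (@lebesgue_scale _ _ t (EFin \o \1_(S t)))//; last 2 first.
  - by apply/measurable_EFinP; exact: measurable_indic.
  - by move=> x; rewrite lee_fin.
  by rewrite integral_indic// setIT.
by rewrite S1 muleA -EFinM mulfV ?mul1e// expf_neq0// gt_eqF.
Qed.

End Cones.

Lemma Rintegral_mscale disp (T : measurableType disp) (R : realType) (k : {nonneg R})
    (m : {measure set T -> \bar R}) (f : T -> R) :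
  m.-integrable setT (EFin \o f) ->
  \int[mscale k m]_x f x = k%:num * \int[m]_x f x.
Proof.
move=> fi; have mf := measurable_int _ fi.
rewrite /Rintegral integralE [in RHS]integralE !ge0_integral_mscale//; last 2 first.
- exact: measurable_funeneg.
- exact: measurable_funepos.
have := integrable_pos_fin_num measurableT fi; have := integrable_neg_fin_num measurableT fi.
rewrite /comp; move: (integral _ _ _) (integral _ _ _) => [b||] [a||]//= _ _.
by rewrite mulrBr.
Qed.

Section DirectionMeasure.
Context {R : realType} {d : nat}.
Local Notation lam := (@lebesgue_rV R d).
Local Notation X := (euclidean R d).
Implicit Types A : set X.

(** The surface measure before multiplication by [surface_factor]. *)
Definition direction_measure : {measure set X -> \bar R} :=
  image_measure (mrestr lam (@measurable_punctured_ball R d)) (@measurable_direction R d).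

Lemma radial_measure_unit A (mA : measurable A) :
  radial_measure mA `]-oo, 1%R]%classic = direction_measure A.
Proof.
rewrite /= /pushforward /mrestr; congr (lam _); apply/seteqP; split => x /=.
  by rewrite in_itv/= => -[x1 [x0 Ax]]; split => //; apply/andP.
by move=> [Ax /andP[x0 x1]]; rewrite in_itv.
Qed.

Lemma direction_measure_fin A : measurable A -> direction_measure A \is a fin_num.
Proof.
move=> mA; rewrite ge0_fin_numE//; apply: le_lt_trans (@punctured_ball_lty R d).
rewrite /= /pushforward /mrestr; apply: le_measure; rewrite ?inE.
- apply: measurableI; last exact: measurable_punctured_ball.
  by rewrite -[X in measurable X]setTI; exact: measurable_direction.
- exact: measurable_punctured_ball.
- exact: subIsetr.
Qed.

Let nng A : {nonneg R} := NngNum (fine_ge0 (measure_ge0 direction_measure A)).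

(** The heart of polar coordinates: the law of |x| on a cone depends on the cone only through its
    mass. On a ray of length t > 0 both sides are t^d times the product of the two direction masses.
    The cross-multiplied form avoids dividing by the total mass. *)
Lemma radial_measure_proportional A (mA : measurable A) (S : set (measurableTypeR R)) :
  measurable S ->
  (direction_measure setT * radial_measure mA S =
   direction_measure A * radial_measure (@measurableT _ X) S)%E.
Proof.
move=> mS.
pose m1 : {measure set (measurableTypeR R) -> \bar R} := mscale (nng setT) (radial_measure mA).
pose m2 : {measure set (measurableTypeR R) -> \bar R} := mscale (nng A) (radial_measure (@measurableT _ X)).
have m1E S' : m1 S' = (direction_measure setT * radial_measure mA S')%E.
  transitivity ((fine (direction_measure setT))%:E * radial_measure mA S')%E => //.
  by rewrite fineK//; exact: direction_measure_fin.
have m2E S' : m2 S' = (direction_measure A * radial_measure (@measurableT _ X) S')%E.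
  transitivity ((fine (direction_measure A))%:E *
    radial_measure (@measurableT _ X) S')%E => //.
  by rewrite fineK//; exact: direction_measure_fin.
rewrite -m1E -m2E.
have ray (t : R) : 0 < t -> forall B (mB : measurable B),
    radial_measure mB `]-oo, t]%classic = ((t ^+ d)%:E * direction_measure B)%E.
  by move=> t0 B mB; rewrite radial_measure_ray// radial_measure_unit.
apply: (@measure_unique _ R (measurableTypeR R) _ (fun n : nat => `]-oo, n.+1%:R]%classic)
   (closed_rays_generate R) _ _ _ m1 m2 _ _ S mS).
- move=> _ _ [x ->] [y ->]; exists (Num.min x y).
  by apply/seteqP; split => z /=; rewrite !in_itv/= le_min; [move=> [-> ->]|move/andP].
- by move=> i; exists i.+1%:R.
- apply/seteqP; split => // x _; exists (Num.bound `|x|) => //=.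
  rewrite in_itv/= (le_trans (ler_norm _))// (le_trans (ltW (archi_boundP _)))//.
  by rewrite ler_nat.
- move=> _ [t ->]; rewrite m1E m2E.
  have [t0|t0] := ltP 0 t; first by rewrite !ray// muleCA [RHS]muleCA (muleC (direction_measure A)).
  have r0 B (mB : measurable B) : radial_measure mB `]-oo, t]%classic = 0%E.
    rewrite /= /pushforward /mrestr (_ : _ `&` _ = set0) ?measure0//.
    apply/seteqP; split => // x /= []; rewrite in_itv/= => xt [x0 _].
    by have := lt_le_trans x0 (le_trans xt t0); rewrite ltxx.
  by rewrite !r0 !mule0.
- move=> n; rewrite m1E ray// muleA lte_mul_pinfty ?mule_ge0 ?lee_fin ?exprn_ge0//.
    by rewrite fin_numM// direction_measure_fin.
  by rewrite ltey_eq direction_measure_fin.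
Qed.

Lemma integral_radial A (mA : measurable A) (phi : R -> R) :
  measurable_fun setT (phi : measurableTypeR R -> R) -> (forall r, 0 <= phi r) ->
  (\int[radial_measure mA]_r (phi r)%:E = \int[lam]_(x in cone A) (phi (enorm x))%:E)%E.
Proof.
move=> mphi phi0.
have me := @measurable_enorm R d.
rewrite ge0_integral_pushforward//; last 2 first.
- by apply/measurable_EFinP.
- by move=> x _; rewrite lee_fin.
rewrite preimage_setT [LHS]ge0_integral_mrestr//.
- by apply/measurable_EFinP; exact: (measurableT_comp mphi).
- by move=> x; rewrite lee_fin.
Qed.

End DirectionMeasure.

Section RadialTransfer.
Context {R : realType} {d : nat}.
Local Notation lam := (@lebesgue_rV R d).
Local Notation X := (euclidean R d).
Local Notation dirm := (@direction_measure R d).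

Context (phi : R -> R) (mphi : measurable_fun setT (phi : measurableTypeR R -> R)).
Context (phi_ge0 : forall r, 0 <= phi r) (phi0 : phi 0 = 0).

Let w (x : X) : R := phi (enorm x).

Let mw : measurable_fun setT w.
Proof. exact: (measurableT_comp mphi (@measurable_enorm R d)). Qed.

(* An opaque copy of lam with a sigma-finite structure, so that unification does
   not unfold the recursive definition of lam. *)
Context (L : {sigma_finite_measure set X -> \bar R}).
Hypothesis LE : L = lam :> (set X -> \bar R).

Let dens := density L mw.

Let eta := image_measure dens (@measurable_direction R d).

(** [eta] is the distribution of directions under Lebesgue measure weighted by phi(|x|). The origin
    lies in no cone, but it also carries no weight because phi 0 = 0. *)
Let etaE A (mA : measurable A) : eta A = (\int[radial_measure mA]_r (phi r)%:E)%E.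
Proof.
have mD : measurable (@direction R d @^-1` A).
  by rewrite -[X in measurable X]setTI; exact: measurable_direction.
rewrite integral_radial//.
transitivity (\int[dens]_x (\1_(@direction R d @^-1` A) x)%:E)%E.
  by rewrite integral_indic// setIT.
rewrite ge0_integral_density//; last by move=> x; exact: phi_ge0.
rewrite LE [RHS]integral_mkcond; apply: eq_integral => x _.
rewrite patchE indicE /cone in_setI; case: (boolP (x \in _ @^-1` _)) => xA.
  rewrite mul1r andbT; case: ifPn => //; rewrite notin_setE /= => /negP.
  rewrite -leNgt => x0; rewrite /w (_ : enorm x = 0) ?phi0//.
  by apply/eqP; rewrite eq_le x0 enorm_ge0.
by rewrite andbF mul0r.
Qed.

Let cone_setT (f : X -> \bar R) : (forall x, enorm x = 0 -> f x = 0%E) ->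
  (\int[lam]_(x in cone setT) f x = \int[lam]_x f x)%E.
Proof.
move=> f0; rewrite integral_mkcond; apply: eq_integral => x _.
rewrite patchE; case: ifPn => //; rewrite notin_setE /cone /= => h.
rewrite f0//; apply/eqP; rewrite eq_le enorm_ge0 andbT leNgt; apply/negP => x0.
by apply: h.
Qed.

(** By proportionality of the radial measures, [eta] and [direction_measure] agree up to constants;
    F is then integrated against both. *)
Lemma radial_transfer_subproof (F : X -> R) : measurable_fun setT F ->
  lam.-integrable setT (fun x => (phi (enorm x))%:E) ->
  dirm.-integrable setT (EFin \o F) ->
  lam.-integrable setT (fun x => (F (direction x) * phi (enorm x))%:E) ->
  fine (dirm setT) * \int[lam]_x (F (direction x) * phi (enorm x)) =
  \int[lam]_x phi (enorm x) * \int[dirm]_x F x.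
Proof.
move=> mF iphi idF iF.
have fdir A : measurable A -> dirm A \is a fin_num by exact: direction_measure_fin.
pose nng A : {nonneg R} := NngNum (fine_ge0 (measure_ge0 dirm A)).
have K0 : 0 <= \int[lam]_x phi (enorm x) by exact: Rintegral_ge0.
pose K : {nonneg R} := NngNum K0.
have etadir A : measurable A -> (mscale (nng setT) eta A = mscale K dirm A)%E.
  move=> mA.
  transitivity ((fine (dirm setT))%:E * eta A)%E => //.
  transitivity ((\int[lam]_x phi (enorm x))%:E * dirm A)%E => //.
  rewrite fineK ?fdir// etaE.
  have mphiE : measurable_fun setT (EFin \o phi : measurableTypeR R -> \bar R).
    by apply/measurable_EFinP.
  rewrite /Rintegral fineK; last exact: (integrable_fin_num _ iphi).
  rewrite -[in RHS](cone_setT (f := fun x => (phi (enorm x))%:E)); last first.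
    by move=> x ->; rewrite phi0.
  rewrite -(integral_radial (@measurableT _ X))//.
  transitivity (\int[mscale (nng setT) (radial_measure mA)]_r (phi r)%:E)%E.
    by rewrite ge0_integral_mscale//= ?fineK ?fdir// => x _; rewrite lee_fin.
  rewrite (eq_measure_integral (mscale (nng A) (radial_measure (@measurableT _ X)))).
    rewrite ge0_integral_mscale//= ?fineK ?fdir// 1?muleC// => x _.
    by rewrite lee_fin.
  move=> S mS _.
  transitivity ((fine (dirm setT))%:E * radial_measure mA S)%E => //.
  transitivity ((fine (dirm A))%:E * radial_measure (@measurableT _ X) S)%E => //.
  by rewrite !fineK ?fdir// radial_measure_proportional.
have md := @measurable_direction R d.
have mFd := measurableT_comp mF md.
have iFL : L.-integrable setT (fun x => ((F \o @direction R d) x * w x)%:E) by rewrite LE.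
have [idens dE] := integral_density mw (fun x => phi_ge0 (enorm x)) mFd iFL.
have LlamE (f : X -> R) : \int[L]_x f x = \int[lam]_x f x.
  congr fine; apply: eq_measure_integral => A _ _.
  by have := congr1 (fun h : set X -> \bar R => h A) LE.
rewrite LlamE in dE.
have iF' : eta.-integrable setT (EFin \o F).
  apply: integrable_pushforward => //.
  by apply/measurable_EFinP.
have etaF : \int[eta]_x F x = \int[lam]_x (F (direction x) * phi (enorm x)).
  transitivity (\int[dens]_x (F \o @direction R d) x); last exact: dE.
  have mEF : measurable_fun setT (EFin \o F) by apply/measurable_EFinP.
  have e := integral_pushforward md mEF idens measurableT.
  rewrite preimage_setT in e; rewrite /Rintegral.
  exact: (f_equal fine e).
rewrite -etaF.
transitivity (\int[mscale (nng setT) eta]_x F x); first by rewrite Rintegral_mscale.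
transitivity (\int[mscale K dirm]_x F x); last by rewrite Rintegral_mscale.
by rewrite /Rintegral; congr fine; apply: eq_measure_integral => A mA _; exact: etadir.
Qed.

End RadialTransfer.

Lemma radial_transfer (R : realType) (d : nat) (phi : R -> R) (F : euclidean R d -> R) :
  measurable_fun setT (phi : measurableTypeR R -> R) -> (forall r, 0 <= phi r) -> phi 0 = 0 ->
  measurable_fun setT F ->
  (@lebesgue_rV R d).-integrable setT (fun x => (phi (enorm x))%:E) ->
  (@direction_measure R d).-integrable setT (EFin \o F) ->
  (@lebesgue_rV R d).-integrable setT (fun x => (F (direction x) * phi (enorm x))%:E) ->
  fine (@direction_measure R d setT) *
    \int[@lebesgue_rV R d]_x (F (direction x) * phi (enorm x)) =
  \int[@lebesgue_rV R d]_x phi (enorm x) * \int[@direction_measure R d]_x F x.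
Proof.
have [L LE] := sigma_finite_measureP (@lebesgue_rV_sigma_finite R d).
by move=> mphi phi_ge0 phi0 mF i1 i2 i3; apply: (radial_transfer_subproof mphi _ _ LE).
Qed.

(** * Polynomials on the sphere *)

Section PolynomialGrowth.
Context {R : realType} {d : nat}.
Implicit Types (p q : mpoly d R) (m : multinom d) (x : euclidean R d).

Lemma monomial_le_enorm m x : `|\prod_(i < d) x ord0 i ^+ m i| <= enorm x ^+ mdeg m.
Proof.
rewrite normr_prod mdegE -prodrXr; apply: ler_prod => i _.
by rewrite normr_ge0 normrX lerXn2r ?nnegrE ?normr_ge0 ?enorm_ge0// coord_le_enorm.
Qed.

Lemma exprn_le1D (r : R) j N : 0 <= r -> (j <= N)%N -> r ^+ j <= 1 + r ^+ N.
Proof.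
move=> r0 jN; have [r1|r1] := leP r 1.
  by rewrite (@le_trans _ _ 1) ?exprn_ile1// lerDl exprn_ge0.
by rewrite (@le_trans _ _ (r ^+ N)) ?lerDr// ler_weXn2l// ltW.
Qed.

Lemma peval_bound p : exists2 C : R, 0 <= C &
  forall x, `|peval p x| <= C * (1 + enorm x ^+ mmeasure mdeg p).
Proof.
exists (\sum_(m <- msupp p) `|mcoeff m p|); first exact: sumr_ge0.
move=> x; rewrite pevalE (le_trans (ler_norm_sum _ _ _))// mulr_suml.
rewrite big_seq [leRHS]big_seq; apply: ler_sum => m mp.
rewrite normrM ler_wpM2l// (le_trans (monomial_le_enorm _ _))//.
rewrite exprn_le1D ?enorm_ge0//; apply/ltnW; exact: mmeasure_mnm_lt.
Qed.

Lemma peval_homog k p (t : R) x : p \is ishomog1 k mdeg ->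
  peval p (t *: (x : 'rV[R]_d) : euclidean R d) = t ^+ k * peval p x.
Proof.
move=> /dhomogP hp; rewrite !pevalE mulr_sumr big_seq [RHS]big_seq.
apply: eq_bigr => m mp; rewrite mulrCA; congr (_ * _).
have -> : k = mdeg m by exact/esym/hp.
rewrite mdegE -prodrXr -big_split/=; apply: eq_bigr => i _.
by rewrite mxE exprMn.
Qed.

End PolynomialGrowth.

Section Sphere.
Context {R : realType} {d : nat}.
Implicit Types (p q : mpoly d R) (m : multinom d) (x : euclidean R d).
Local Notation lam := (@lebesgue_rV R d).
Local Notation dirm := (@direction_measure R d).
Local Notation surf := (@surface_measure R d).
Local Notation S := (@sphere R d).

Lemma surface_measureE A : surf A = ((surface_factor d)%:num%:E * dirm A)%E.
Proof. by []. Qed.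

Lemma measurable_sphere : measurable S.
Proof.
rewrite (_ : S = @enorm R d @^-1` [set 1]) //.
by rewrite -[X in measurable X]setTI; exact: measurable_enorm.
Qed.

Lemma direction_measure_sphereC : dirm (~` S) = 0%E.
Proof.
rewrite /= /pushforward /mrestr (_ : _ `&` _ = set0) ?measure0//.
by apply/seteqP; split => // x [/= xS /andP[x0 _]]; apply: xS; exact: enorm_direction.
Qed.

Lemma surface_measure_sphereC : surf (~` S) = 0%E.
Proof. by rewrite surface_measureE direction_measure_sphereC mule0. Qed.

Lemma surface_measure_lty : (surf setT < +oo)%E.
Proof.
rewrite surface_measureE lte_mul_pinfty ?lee_fin//.
by rewrite ltey_eq direction_measure_fin.
Qed.

Lemma integrable_direction_measure p : dirm.-integrable setT (EFin \o peval p).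
Proof.
have mS := measurable_sphere.
have mp : measurable_fun setT (EFin \o (peval p : euclidean R d -> R)).
  by apply/measurable_EFinP; exact: measurable_peval.
apply/(negligible_integrable (measurableC mS)) => //.
  exact: direction_measure_sphereC.
rewrite setTD setCK.
have [C C0 bC] := peval_bound p.
apply: (@le_integrable _ _ _ _ _ mS _ (cst (C * 2)%:E)) => //.
- exact: measurable_funTS.
- move=> x /= xS; rewrite lee_fin (le_trans (bC x))// xS expr1n.
  by rewrite ger0_norm// mulr_ge0.
- apply/integrableP; split => //.
  rewrite (eq_integral (cst (C * 2)%:E)) => [|x _]; last by rewrite /= ger0_norm ?mulr_ge0.
  rewrite integral_cst// lte_mul_pinfty ?lee_fin ?mulr_ge0//.
  by rewrite ltey_eq direction_measure_fin.
Qed.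

Lemma integrable_surface_measure p : surf.-integrable setT (EFin \o peval p).
Proof.
have /integrableP[mp ip] := integrable_direction_measure p.
apply/integrableP; split => //.
rewrite ge0_integral_mscale//; last exact: measurableT_comp.
by rewrite lte_mul_pinfty ?lee_fin// ge0_fin_numE// integral_ge0.
Qed.

(** |x|^2 as a polynomial: its powers dominate the possibly non-polynomial |x|^n, so Gaussian
    integrability of polynomials suffices. *)
Definition enorm_sqr_poly : mpoly d R :=
  \sum_(i < d) mpolyX R (mnm1 i) * mpolyX R (mnm1 i).

Lemma peval_enorm_sqr x : peval enorm_sqr_poly x = enorm x ^+ 2.
Proof.
rewrite /enorm sqr_sqrtr; last by apply: sumr_ge0 => i _; exact: sqr_ge0.
rewrite /peval raddf_sum/=; apply: eq_bigr => i _.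
by rewrite mevalM mevalXU expr2.
Qed.

(** The radial factor of a Gaussian-weighted homogeneous polynomial of degree n; the absolute value
    makes it non-negative on the whole line. *)
Let phi n (r : R) : R := `|r| ^+ n * expR (- r ^+ 2).

Let phi_ge0 n r : 0 <= phi n r.
Proof. by rewrite mulr_ge0// ?exprn_ge0 ?expR_ge0. Qed.

Let measurable_phi n : measurable_fun setT (phi n : measurableTypeR R -> R).
Proof.
apply: measurable_funM; first by apply: measurable_funX; exact: normr_measurable.
by apply: measurableT_comp => //; exact: measurableT_comp.
Qed.

Let phiE n x : phi n (enorm x) = enorm x ^+ n * gauss_weight x.
Proof. by rewrite /phi ger0_norm ?enorm_ge0// gauss_weightE. Qed.

Let measurable_phi_enorm n :
  measurable_fun setT (fun x : euclidean R d => (phi n (enorm x))%:E).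
Proof.
by apply/measurable_EFinP; exact: (measurableT_comp (measurable_phi n) (@measurable_enorm R d)).
Qed.

Let integrable_phi n : lam.-integrable setT (fun x => (phi n (enorm x))%:E).
Proof.
apply: (le_integrable _ _ _ (integrable_peval_gauss (1 + enorm_sqr_poly ^+ n))) => //.
move=> x _; rewrite lee_fin ger0_norm// phiE.
rewrite (_ : peval _ x = 1 + enorm x ^+ (2 * n)); last first.
  rewrite {1}/peval mevalD meval1 rmorphXn /= -/(peval _ x) peval_enorm_sqr.
  by rewrite exprM.
rewrite ger0_norm; last first.
  by rewrite mulr_ge0 ?gauss_weightE ?expR_ge0// addr_ge0// exprn_ge0// enorm_ge0.
rewrite ler_wpM2r ?gauss_weightE ?expR_ge0// exprn_le1D ?enorm_ge0//.
by rewrite leq_pmull.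
Qed.

(** phi n is positive away from the origin, so a zero integral would make the punctured ball
    null. *)
Let phi_integral_neq0 n : dirm setT != 0%E -> \int[lam]_x phi n (enorm x) != 0.
Proof.
apply: contra_neq => K0.
have : (\int[lam]_x `|(phi n (enorm x))%:E| = 0)%E.
  rewrite (eq_integral (fun x => (phi n (enorm x))%:E)) => [|x _]; last by rewrite /= ger0_norm.
  move: K0; rewrite /Rintegral => /eqP; rewrite fine_eq0.
    by move/eqP.
  exact: (integrable_fin_num _ (integrable_phi n)).
move/(ae_eq_integral_abs _ measurableT (measurable_phi_enorm n)) => [N [mN N0 sN]].
apply/eqP; rewrite eq_le measure_ge0 andbT -N0.
rewrite /= /pushforward /mrestr preimage_setT setTI.
apply: le_measure; rewrite ?inE//; first exact: measurable_punctured_ball.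
move=> x /= /andP[x0 _]; apply: sN => /= h.
have := h I => -[]; rewrite /phi ger0_norm ?enorm_ge0// => /eqP.
by rewrite mulf_eq0 expf_eq0 !gt_eqF ?andbF// expR_gt0.
Qed.

(** Since q(x) exp (-|x|^2) = q(x/|x|) phi n |x|, the Gaussian integral is a radial constant times
    the spherical one, up to the total mass. Positivity of n gives phi n 0 = 0. *)
Lemma homogeneous_sphere_integral n q : (0 < n)%N -> q \is ishomog1 n mdeg ->
  gauss_functional q = 0 -> \int[dirm]_x peval q x = 0.
Proof.
move=> n0 hq q0.
have mq : measurable_fun setT (peval q : euclidean R d -> R) by exact: measurable_peval.
have qE x : peval q (direction x) * phi n (enorm x) = peval q x * gauss_weight x.
  by rewrite phiE mulrA (mulrC (peval _ _)) -(peval_homog _ _ hq) directionK.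
have phi0 : phi n 0 = 0 by rewrite /phi normr0 expr0n (gtn_eqF n0) mul0r.
have iq : lam.-integrable setT (fun x => (peval q (direction x) * phi n (enorm x))%:E).
  by under eq_fun do rewrite qE; exact: integrable_peval_gauss.
have := radial_transfer (measurable_phi n) (phi_ge0 n) phi0 mq (integrable_phi n)
  (integrable_direction_measure q) iq.
rewrite (_ : \int[lam]_x (peval q (direction x) * phi n (enorm x)) = 0); last first.
  by rewrite -q0; apply: eq_Rintegral => x _; rewrite qE.
(* If the direction measure is null, the radial constant cannot be cancelled, but the claim is
   immediate. *)
rewrite mulr0; have [dT|dT] := eqVneq (dirm setT) 0%E.
  move=> _; rewrite /Rintegral null_set_integral//.
  exact: (measurable_int _ (integrable_direction_measure q)).
move=> /esym/eqP; rewrite mulf_eq0 (negbTE (phi_integral_neq0 n dT))/=.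
by move/eqP.
Qed.

Lemma sphere_integralE q : \int[surf]_(x in S) peval q x =
  (surface_factor d)%:num * \int[dirm]_x peval q x.
Proof.
rewrite -Rintegral_mscale; last exact: integrable_direction_measure.
rewrite /Rintegral; congr fine; rewrite [RHS](negligible_integral (N := ~` S))//.
- by rewrite setTD setCK.
- exact: (measurableC measurable_sphere).
- exact: integrable_surface_measure.
- exact: surface_measure_sphereC.
Qed.

(** As [mmeasure] is one more than the degree, the hypothesis reads deg q < k. Each monomial of q
    times p is homogeneous of positive degree and has Gaussian integral 0. *)
Lemma sphere_orthogonal k p q : p \is ishomog1 k mdeg ->
  \sum_(i < d) mderiv i (mderiv i p) = 0 -> (mmeasure mdeg q <= k)%N ->
  \int[surf]_(x in S) peval (q * p) x = 0.
Proof.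
move=> hp Dp qk; rewrite sphere_integralE.
rewrite (_ : \int[dirm]_x peval (q * p) x = 0) ?mulr0//.
transitivity (\int[dirm]_x (\sum_(m <- msupp q) mcoeff m q * peval (mpolyX R m * p) x)).
  apply: eq_Rintegral => x _; rewrite {1}[q]mpolyE mulr_suml /peval raddf_sum/=.
  by apply: eq_bigr => m _; rewrite -scalerAl mevalZ.
rewrite /Rintegral; under eq_integral do rewrite -sumEFin.
rewrite integral_sum// => [|m]; last first.
  exact: (integrableZl measurableT _ (integrable_direction_measure (mpolyX R m * p))).
rewrite big_seq big1// => m mq.
have mk : (mdeg m < k)%N by rewrite (leq_trans _ qk)// mmeasure_mnm_lt.
have hm : mpolyX R m * p \is ishomog1 (mdeg m + k) mdeg.
  by apply: dhomogM => //; rewrite dhomogX.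
have E0 : gauss_functional (mpolyX R m * p) = 0.
  exact: (harmonic_orthogonal gauss_functionalD gauss_functionalZ gauss_functional_mderiv hp Dp mk).
have := homogeneous_sphere_integral _ hm E0; rewrite addn_gt0 (leq_ltn_trans _ mk)// orbT.
move=> /(_ isT); rewrite /Rintegral => /eqP.
have ifin := integrable_fin_num measurableT (integrable_direction_measure (mpolyX R m * p)).
rewrite fine_eq0// => /eqP I0.
under eq_integral do rewrite EFinM.
rewrite integralZl//; last exact: integrable_direction_measure.
by rewrite I0 mule0.
Qed.

End Sphere.

(** * Measures in polar coordinates *)

Section Polar.
Context {R : realType} {d : nat}.
Local Notation X := (euclidean R d).
Local Notation S := (@sphere R d).
Local Notation surf := (@surface_measure R d).
Local Notation halfline := (`[0%R, +oo[%classic : set (measurableTypeR R)).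

Definition polar (z : measurableTypeR R * X) : X := z.1 *: (z.2 : 'rV[R]_d).

Lemma measurable_polar : measurable_fun setT polar.
Proof.
apply: measurable_euclidean => i; under eq_fun do rewrite mxE.
apply: measurable_funM; first exact: measurable_fst.
by apply: (measurableT_comp (measurable_coord i)); exact: measurable_snd.
Qed.

(** At r = 0 and k > 0 the field inverse makes the weight 0; the measures it is used with have no
    atom there. *)
Definition polar_weight (k : nat) (y : mpoly d R) (z : measurableTypeR R * X) : R :=
  \1_(halfline `*` S) z * (z.1 ^- k * peval y z.2).

Lemma measurable_halfline : measurable halfline.
Proof. exact: measurable_itv. Qed.

Lemma measurable_invX k : measurable_fun setT (fun r : measurableTypeR R => r ^- k : measurableTypeR R).
Proof. by apply: (measurableT_comp measurable_inv_real); exact: measurable_funX. Qed.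

Lemma measurable_polar_weight k y : measurable_fun setT (polar_weight k y).
Proof.
apply: measurable_funM.
  by apply: measurable_indic; apply: measurableX; [exact: measurable_halfline|exact: measurable_sphere].
apply: measurable_funM.
  by apply: (measurableT_comp (measurable_invX k)); exact: measurable_fst.
by apply: (measurableT_comp (measurable_peval y)); exact: measurable_snd.
Qed.

Context (s : {finite_measure set (measurableTypeR R) -> \bar R}).
Context (su : {finite_measure set X -> \bar R}).
Variables (k : nat) (y : mpoly d R).
Local Notation P := (s \x su)%E.
Local Notation W := (polar_weight k y).

Definition polar_moment N : \bar R := (\int[s]_(r in halfline) ((1 + r ^+ N) * r ^- k)%:E)%E.

Lemma ge0_integral_prod (a : R -> R) (b : X -> R) :
  measurable_fun setT (a : measurableTypeR R -> R) -> measurable_fun setT b ->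
  (forall r, 0 <= a r) -> (forall t, 0 <= b t) ->
  (\int[P]_z (a z.1 * b z.2)%:E = \int[s]_r (a r)%:E * \int[su]_t (b t)%:E)%E.
Proof.
move=> ma mb a0 b0.
have mE : measurable_fun setT (fun z : measurableTypeR R * X => (a z.1 * b z.2)%:E).
  apply/measurable_EFinP; apply: measurable_funM.
    by apply: (measurableT_comp ma); exact: measurable_fst.
  by apply: (measurableT_comp mb); exact: measurable_snd.
rewrite fubini_tonelli1//; last by move=> z; rewrite lee_fin mulr_ge0.
rewrite -ge0_integralZr//.
- apply: eq_integral => r _; rewrite /fubini_F.
  transitivity (\int[su]_t ((a r)%:E * (EFin \o b) t))%E.
    by apply: eq_integral => t _; rewrite EFinM.
  rewrite ge0_integralZl_EFin//; last by apply/measurable_EFinP.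
  by move=> t _; rewrite lee_fin.
- by apply/measurable_EFinP.
- by move=> r _; rewrite lee_fin.
- by apply: integral_ge0 => t _; rewrite lee_fin.
Qed.

(** Where the weight lives, |r t| = r, so the integrand is a function of r times a function of t. *)
Lemma polar_weight_integral N :
  (\int[P]_z ((1 + enorm (polar z) ^+ N) * `|W z|)%:E =
   polar_moment N * \int[su]_(t in S) `|peval y t|%:E)%E.
Proof.
pose a (r : R) : R := \1_halfline r * ((1 + r ^+ N) * r ^- k).
pose b (t : X) : R := \1_S t * `|peval y t|.
transitivity (\int[P]_z (a z.1 * b z.2)%:E)%E.
  apply: eq_integral => -[r t] _; congr EFin.
  rewrite /polar_weight /a /b /= !indicE in_setX /=.
  case: (boolP (r \in _)) => /= r0; last by rewrite !mul0r normr0 mulr0.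
  case: (boolP (t \in _)) => /= tS; last by rewrite !mul0r normr0 !mulr0.
  move: r0 tS; rewrite !inE /= in_itv/= andbT => r0 tS.
  rewrite !mul1r normrM (ger0_norm (_ : 0 <= r ^- k)) ?invr_ge0 ?exprn_ge0//.
  by rewrite /polar /= enormZ// tS mulr1 !mulrA.
rewrite ge0_integral_prod.
- congr (_ * _)%E; rewrite [RHS]integral_mkcond; apply: eq_integral => x _.
    by rewrite patchE /a indicE; case: (boolP (x \in _)) => _; rewrite ?mul1r ?mul0r.
  by rewrite patchE /b indicE; case: (boolP (x \in _)) => _; rewrite ?mul1r ?mul0r.
- apply: measurable_funM; first by apply: measurable_indic; exact: measurable_halfline.
  apply: measurable_funM; last exact: measurable_invX.
  by apply: measurable_funD => //; exact: measurable_funX.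
- apply: measurable_funM; first by apply: measurable_indic; exact: measurable_sphere.
  by apply: measurableT_comp => //; exact: measurable_peval.
- move=> r; rewrite /a indicE; case: (boolP (r \in _)) => //=; last by rewrite mul0r.
  rewrite inE /= in_itv/= andbT => r0.
  by rewrite !mulr_ge0 ?addr_ge0 ?invr_ge0 ?exprn_ge0.
- by move=> t; rewrite mulr_ge0.
Qed.

Let mP := measurable_funrpos (measurable_polar_weight k y).
Let mN := measurable_funrneg (measurable_polar_weight k y).

Let P_lty : (P setT < +oo)%E.
Proof.
rewrite -setXTT product_measure1E//; apply: lte_mul_pinfty => //.
  exact: fin_num_measure.
by rewrite ltey_eq fin_num_measure.
Qed.

Let Pf : {finite_measure set (measurableTypeR R * X)%type -> \bar R} := finite_of P_lty.

Definition polar_pos : {measure set X -> \bar R} := image_measure (density Pf mP) measurable_polar.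
Definition polar_neg : {measure set X -> \bar R} := image_measure (density Pf mN) measurable_polar.

Let weight_parts z : (W^\+)%R z + (W^\-)%R z = `|W z|.
Proof. by have /(congr1 (@^~ z)) := funrposDneg W. Qed.

Section Growth.
Variables (f : X -> R) (C : R) (N : nat).
Hypothesis mf : measurable_fun setT f.
Hypothesis bf : forall x, `|f x| <= C * (1 + enorm x ^+ N).

Let mfp : measurable_fun setT (f \o polar).
Proof. exact: measurableT_comp mf measurable_polar. Qed.

Let C_ge0 : 0 <= C.
Proof.
have := le_trans (normr_ge0 _) (bf (0 : 'rV[R]_d)).
rewrite pmulr_lge0// ltr_pwDl// exprn_ge0// enorm_ge0//.
Qed.

(** A general v between 0 and |W| covers W^+, W^- and |W| at once. *)
Let bound_le (v : measurableTypeR R * X -> R) : measurable_fun setT v ->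
  (forall z, 0 <= v z <= `|W z|) ->
  (\int[P]_z (`|f (polar z)| * v z)%:E <=
   C%:E * (polar_moment N * \int[su]_(t in S) `|peval y t|%:E))%E.
Proof.
move=> mv vW.
have mg : measurable_fun setT (fun z => ((1 + enorm (polar z) ^+ N) * `|W z|)%:E).
  apply/measurable_EFinP; apply: measurable_funM.
    apply: measurable_funD => //; apply: measurable_funX.
    exact: (measurableT_comp (@measurable_enorm R d) measurable_polar).
  by apply: measurableT_comp => //; exact: measurable_polar_weight.
rewrite -polar_weight_integral -ge0_integralZl_EFin//; last first.
  by move=> z _; rewrite lee_fin mulr_ge0// addr_ge0// exprn_ge0// enorm_ge0.
apply: ge0_le_integral => //.
- by move=> z _; rewrite lee_fin mulr_ge0//; case/andP: (vW z).
- by apply/measurable_EFinP; apply: measurable_funM => //; apply: measurableT_comp.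
- exact: measurable_funeM.
- move=> z _; rewrite -EFinM lee_fin mulrA; have /andP[v0 v1] := vW z.
  by rewrite ler_pM.
Qed.

Let parts_le z : 0 <= (W^\+)%R z <= `|W z| /\ 0 <= (W^\-)%R z <= `|W z|.
Proof.
have p := funrpos_ge0 W z; have n := funrneg_ge0 W z.
by rewrite -weight_parts p n lerDl lerDr p n.
Qed.

Let abs_le (v : measurableTypeR R * X -> R) (mv : measurable_fun setT v) : (forall z, 0 <= v z <= `|W z|) ->
  (\int[image_measure (density Pf mv) measurable_polar]_x `|(f x)%:E| <=
   C%:E * (polar_moment N * \int[su]_(t in S) `|peval y t|%:E))%E.
Proof.
move=> vW; have v0 z : 0 <= v z by case/andP: (vW z).
apply: le_trans (bound_le mv vW).
rewrite ge0_integral_pushforward//; last 2 first.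
- exact: measurable_polar.
- by apply: measurableT_comp => //; apply/measurable_EFinP.
have e : (\int[density Pf mv]_z (`|f (polar z)|)%:E = \int[P]_z (`|f (polar z)| * v z)%:E)%E.
  by apply: (ge0_integral_density Pf mv v0) => //; exact: measurableT_comp.
by rewrite preimage_setT [leLHS]e.
Qed.

Lemma polar_pos_le : (\int[polar_pos]_x `|(f x)%:E| <=
   C%:E * (polar_moment N * \int[su]_(t in S) `|peval y t|%:E))%E.
Proof. by apply: abs_le => z; exact: (parts_le z).1. Qed.

Lemma polar_neg_le : (\int[polar_neg]_x `|(f x)%:E| <=
   C%:E * (polar_moment N * \int[su]_(t in S) `|peval y t|%:E))%E.
Proof. by apply: abs_le => z; exact: (parts_le z).2. Qed.

Hypothesis iy : su.-integrable setT (EFin \o peval y).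
Hypothesis iN : (polar_moment N < +oo)%E.

Let iSy : su.-integrable S (EFin \o peval y).
Proof. by apply: integrableS iy => //; exact: measurable_sphere. Qed.

Let bound_lty : (C%:E * (polar_moment N * \int[su]_(t in S) `|peval y t|%:E) < +oo)%E.
Proof.
have moment_ge0 : (0 <= polar_moment N)%E.
  apply: integral_ge0 => r /=; rewrite in_itv/= andbT => r0.
  by rewrite lee_fin mulr_ge0 ?addr_ge0 ?invr_ge0 ?exprn_ge0.
have Iy : (\int[su]_(t in S) `|peval y t|%:E < +oo)%E by case/integrableP: iSy.
apply: lte_mul_pinfty; rewrite ?lee_fin//; apply: lte_mul_pinfty => //.
by rewrite ge0_fin_numE.
Qed.

Let integrable_part (v : measurableTypeR R * X -> R) : measurable_fun setT v -> (forall z, `|v z| <= `|W z|) ->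
  P.-integrable setT (fun z => (f (polar z) * v z)%:E).
Proof.
move=> mv vW; apply/integrableP; split.
  by apply/measurable_EFinP; apply: measurable_funM.
apply: le_lt_trans bound_lty.
have mv' : measurable_fun setT (fun z => `|v z|) by exact: measurableT_comp.
rewrite (eq_integral (fun z => (`|f (polar z)| * `|v z|)%:E)) => [|z _]; last first.
  by rewrite /= normrM.
by apply: bound_le => // z; rewrite normr_ge0 vW.
Qed.

(** The parts recombine by W^+ - W^- = W, and Fubini integrates over the sphere first. *)
Lemma polar_signed_integral :
  \int[polar_pos]_x f x - \int[polar_neg]_x f x =
  \int[s]_(r in halfline) (r ^- k *
     \int[su]_(t in S) (f (r *: (t : 'rV[R]_d)) * peval y t)).
Proof.
have vp z : `|(W^\+)%R z| <= `|W z|.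
  by rewrite ger0_norm ?funrpos_ge0//; have [/andP[]] := parts_le z.
have vn z : `|(W^\-)%R z| <= `|W z|.
  by rewrite ger0_norm ?funrneg_ge0//; have [_ /andP[]] := parts_le z.
have ip : Pf.-integrable setT _ := integrable_part mP vp.
have i_n : Pf.-integrable setT _ := integrable_part mN vn.
have iw := integrable_part (measurable_polar_weight k y) (fun z => lexx _).
have mEf : measurable_fun setT (EFin \o f) by apply/measurable_EFinP.
have [dp pE] := integral_density mP (fun z => funrpos_ge0 _ _) mfp ip.
have [dn nE] := integral_density mN (fun z => funrneg_ge0 _ _) mfp i_n.
have posE : \int[polar_pos]_x f x = \int[P]_z (f (polar z) * (W^\+)%R z).
  apply: etrans _ pE; rewrite /Rintegral.
  have e := integral_pushforward measurable_polar mEf dp measurableT.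
  by rewrite preimage_setT in e; exact: (f_equal fine e).
have negE : \int[polar_neg]_x f x = \int[P]_z (f (polar z) * (W^\-)%R z).
  apply: etrans _ nE; rewrite /Rintegral.
  have e := integral_pushforward measurable_polar mEf dn measurableT.
  by rewrite preimage_setT in e; exact: (f_equal fine e).
apply: etrans (f_equal2 (fun u v : R => u - v) posE negE) _ => /=.
rewrite -RintegralB//.
transitivity (\int[P]_z (f (polar z) * W z)).
  by apply: eq_Rintegral => z _; rewrite -mulrBr -[in RHS](funrposBneg W).
rewrite /Rintegral -(integral12_prod_meas1 iw); congr fine.
rewrite [RHS]integral_mkcond; apply: eq_integral => r _.
rewrite patchE /polar_weight /fubini_F; case: ifPn => r0; last first.
  rewrite integral0_eq// => t _; rewrite indicE in_setX /= (negbTE r0)/=.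
  by rewrite mul0r mulr0.
move: (r0); rewrite inE /= in_itv/= andbT => r0'.
(* For fixed r the growth bound makes f(r t) bounded on the sphere; this integrability lets r^-k
   leave the inner integral. *)
have irt : su.-integrable S (fun t => (f (r *: (t : 'rV[R]_d)) * peval y t)%:E).
  have mS := @measurable_sphere R d.
  apply: (@le_integrable _ _ _ _ _ mS _ (fun t => (C * (1 + r ^+ N))%:E * (peval y t)%:E)%E).
  - apply/measurable_EFinP; apply: measurable_funTS; apply: measurable_funM.
      exact: (measurableT_comp mf (measurableT_comp measurable_polar (pair1_measurable r))).
    exact: measurable_peval.
  - move=> t tS; rewrite lee_fin !normrM ler_wpM2r//.
    rewrite (le_trans (bf _))// enormZ// tS mulr1.
    by rewrite -normrM ler_norm.
  - exact: integrableZl.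
rewrite EFinM fineK; last by apply: integrable_fin_num irt; exact: measurable_sphere.
rewrite -integralZl//; last exact: measurable_sphere.
rewrite [RHS]integral_mkcond; apply: eq_integral => t _.
rewrite patchE indicE in_setX /= r0/=; case: (boolP (t \in S)) => _.
  by rewrite mul1r mulrCA EFinM.
by rewrite mul0r mulr0.
Qed.

End Growth.

End Polar.

(** * Passage between real and complex polynomials *)

Section RealAndComplexPolynomials.
Context {R : realType} {d : nat}.
Implicit Types (p q : mpoly d R) (f : mpoly d R[i]) (x : euclidean R d).
Local Open Scope complex_scope.

Lemma complexify_homog k p : complexify p \is ishomog1 k mdeg -> p \is ishomog1 k mdeg.
Proof.
move=> /dhomogP hp; apply/dhomogP => m; rewrite mcoeff_msupp => mp.
apply: hp; rewrite mcoeff_msupp mcoeff_map_mpoly.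
by rewrite fmorph_eq0.
Qed.

Lemma complexify_mderiv i p : complexify (mderiv i p) = mderiv i (complexify p).
Proof.
apply/mpolyP => m; rewrite mcoeff_deriv !mcoeff_map_mpoly mcoeff_deriv.
exact: rmorphMn.
Qed.

Lemma complexify_harmonic p : laplacian (complexify p) = 0 ->
  \sum_(i < d) mderiv i (mderiv i p) = 0.
Proof.
move=> h; have {}h : complexify (\sum_(i < d) mderiv i (mderiv i p)) = 0.
  rewrite -h /laplacian /complexify raddf_sum; apply: eq_bigr => i _.
  exact: etrans (complexify_mderiv _ _) (congr1 _ (complexify_mderiv _ _)).
apply/mpolyP => m; rewrite mcoeff0; apply: (fmorph_inj (real_complex R)).
by rewrite -mcoeff_map_mpoly -/(complexify _) h mcoeff0 rmorph0.
Qed.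

Lemma cpeval_complexify p x : cpeval (complexify p) x = (peval p x)%:C.
Proof.
have -> : complexify p = \sum_(m <- msupp p) (mcoeff m p)%:C *: mpolyX R[i] m.
  rewrite /complexify {1}[p]mpolyE raddf_sum/=; apply: eq_bigr => m _.
  by rewrite map_mpolyZ map_mpolyX.
rewrite pevalE rmorph_sum /cpeval raddf_sum/=; apply: eq_bigr => m _.
rewrite mevalZ mevalX rmorphM rmorph_prod/=.
by congr (_ * _); apply: eq_bigr => i _; rewrite rmorphXn.
Qed.

(** Used with c the real or the imaginary part, which commute with evaluation at real points. *)
Definition coord_mpoly (c : R[i] -> R) f : mpoly d R :=
  \sum_(m <- msupp f) c (mcoeff m f) *: mpolyX R m.

(** Coefficients may be sent to 0 and the degree may drop; an inequality is enough for a sum cut at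
    the degree of f to be long enough for both parts. *)
Lemma mmeasure_coord_mpoly c f : (mmeasure mdeg (coord_mpoly c f) <= mmeasure mdeg f)%N.
Proof.
rewrite [leqLHS]mmeasureE; apply/bigmax_leqP_seq => m + _; rewrite mcoeff_msupp => mp.
apply: mmeasure_mnm_lt; apply: contraNT mp => mf.
rewrite /coord_mpoly raddf_sum/= big_seq big1// => m' m'f.
rewrite mcoeffZ mcoeffX; case: eqP => [m'm|_]; last by rewrite mulr0.
by rewrite m'm (negbTE mf) in m'f.
Qed.

Lemma cpeval_coord (c : {additive R[i] -> R}) f x :
  (forall z w, c (z * w%:C) = c z * w) -> c (cpeval f x) = peval (coord_mpoly c f) x.
Proof.
move=> cM; rewrite /cpeval mevalE /coord_mpoly /peval !raddf_sum/=; apply: eq_bigr => m _.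
rewrite mevalZ mevalX -cM rmorph_prod/=; congr (c (_ * _)); apply: eq_bigr => i _.
by rewrite rmorphXn.
Qed.

Lemma cpeval_Re f x : complex.Re (cpeval f x) = peval (coord_mpoly (@complex.Re R) f) x.
Proof. by apply: (@cpeval_coord (@complex.Re R)) => -[a b] w; rewrite /= mulr0 subr0. Qed.

Lemma cpeval_Im f x : complex.Im (cpeval f x) = peval (coord_mpoly (@complex.Im R) f) x.
Proof. by apply: (@cpeval_coord (@complex.Im R)) => -[a b] w; rewrite /= mulr0 add0r. Qed.

Lemma mmeasure_homog k p : p \is ishomog1 k mdeg -> (mmeasure mdeg p <= k.+1)%N.
Proof.
move=> /dhomogP hp; rewrite mmeasureE; apply/bigmax_leqP_seq => m mp _.
by rewrite ltnS; have -> : k = mdeg m by exact/esym/hp.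
Qed.

End RealAndComplexPolynomials.

(** * Laplace-Fourier coefficients of real polynomials *)

Section SphereCoefficient.
Context {R : realType} {d : nat}.
Implicit Types (p q y : mpoly d R).
Local Notation surf := (@surface_measure R d).
Local Notation S := (@sphere R d).

Definition sphere_coefficient p y (r : R) : R :=
  \int[surf]_(t in S) (peval p (r *: (t : 'rV[R]_d)) * peval y t).

(** The coefficient is a polynomial in r, which yields its measurability and its continuity at 0. *)
Lemma sphere_coefficientE p y r : sphere_coefficient p y r =
  \sum_(m <- msupp p) (mcoeff m p * \int[surf]_(t in S) peval (mpolyX R m * y) t) * r ^+ mdeg m.
Proof.
have iS q : surf.-integrable S (EFin \o peval q).
  apply: integrableS (integrable_surface_measure q) => //; exact: measurable_sphere.
have mS := @measurable_sphere R d.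
rewrite /sphere_coefficient /Rintegral.
rewrite (eq_integral (fun t => \sum_(m <- msupp p)
    ((mcoeff m p * r ^+ mdeg m)%:E * (peval (mpolyX R m * y) t)%:E))%E); last first.
  move=> t _; rewrite pevalE mulr_suml -sumEFin; apply: eq_bigr => m _.
  rewrite -EFinM; congr EFin; rewrite -!mulrA; congr (_ * _).
  rewrite /peval mevalM mevalX mulrA; congr (_ * _).
  by rewrite mdegE -prodrXr -big_split/=; apply: eq_bigr => i _; rewrite mxE exprMn.
rewrite integral_sum//; last by move=> m; apply: integrableZl (iS _).
under eq_bigr => m _.
  rewrite integralZl ?iS//.
  rewrite -[X in (_ * X)%E](fineK (integrable_fin_num mS (iS (mpolyX R m * y)))) -EFinM.
  over.
rewrite sumEFin /=; apply: eq_bigr => m _.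
by rewrite mulrAC.
Qed.

Lemma sphere_coefficient_eq0 k p y r : y \is ishomog1 k mdeg ->
  \sum_(i < d) mderiv i (mderiv i y) = 0 -> (mmeasure mdeg p <= k)%N ->
  sphere_coefficient p y r = 0.
Proof.
move=> hy Dy pk; rewrite sphere_coefficientE big_seq big1// => m mp.
rewrite (sphere_orthogonal hy Dy) ?mulr0 ?mul0r//.
by rewrite mmeasureX (leq_trans _ pk)// mmeasure_mnm_lt.
Qed.

Lemma measurable_sphere_coefficient p y :
  measurable_fun setT (sphere_coefficient p y : measurableTypeR R -> R).
Proof.
rewrite (_ : sphere_coefficient p y = (fun r => \sum_(m <- msupp p)
   (mcoeff m p * \int[surf]_(t in S) peval (mpolyX R m * y) t) * r ^+ mdeg m)); last first.
  by apply/funext => r; rewrite sphere_coefficientE.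
apply: measurable_sum => m; apply: measurable_funM => //; exact: measurable_funX.
Qed.

Lemma sphere_coefficient_cvg0 p y :
  sphere_coefficient p y r @[r --> 0^'+] --> sphere_coefficient p y 0.
Proof.
apply: cvg_at_right_filter; rewrite (_ : sphere_coefficient p y = (fun r => \sum_(m <- msupp p)
   (mcoeff m p * \int[surf]_(t in S) peval (mpolyX R m * y) t) * r ^+ mdeg m)); last first.
  by apply/funext => r; rewrite sphere_coefficientE.
elim: (msupp p) => [|m s ih].
  rewrite big_nil; apply: cvg_near_cst; near=> r; by rewrite big_nil.
rewrite big_cons; under eq_fun do rewrite big_cons.
apply: cvgD ih; apply: cvgM; [exact: cvg_cst|exact: exprn_continuous].
Unshelve. all: by end_near. Qed.

End SphereCoefficient.

(** * The representing measure *)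

Section RadialMeasures.
Context {R : realType}.
Variables (m : {measure set (measurableTypeR R) -> \bar R}) (k : nat).
Local Open Scope ereal_scope.
Local Notation halfline := (`[0%R, +oo[%classic : set (measurableTypeR R)).

(** One term of [moment_bound], with the extended inverse, equal to +oo at r = 0 for k > 0. *)
Definition radial_moment N : \bar R :=
  \int[m]_(r in halfline) ((r ^+ N)%:E * ((r ^+ k)%:E)^-1).

Hypothesis m_support : m `]-oo, 0%R[%classic = 0.
Hypothesis m_bound : forall N, radial_moment N < +oo.

Let h N (r : R) : \bar R := (r ^+ N)%:E * ((r ^+ k)%:E)^-1.

Let h_ge0 N (r : R) : (0 <= r)%R -> 0 <= h N r.
Proof. by move=> r0; rewrite mule_ge0 ?inve_ge0 ?lee_fin ?exprn_ge0. Qed.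

Let hE N (r : R) : (0 < r)%R || (k == 0)%N -> h N r = (r ^+ N * r ^- k)%:E.
Proof.
move=> rk; rewrite /h inver expf_eq0; case: ifPn => [/andP[k0 /eqP r0]|_].
  by move: rk; rewrite r0 ltxx/= (gtn_eqF k0).
by rewrite EFinM.
Qed.

Let mh N : measurable_fun halfline (h N : measurableTypeR R -> \bar R).
Proof.
rewrite (_ : h N = (fun r => if ((r == 0) && (0 < k)%N)%R then (0 ^+ N)%:E * +oo
   else (r ^+ N * r ^- k)%:E)); last first.
  apply/funext => r; rewrite /h inver expf_eq0 andbC.
  by case: ifPn => // /andP[/eqP -> _].
apply: measurable_funTS; apply: measurable_fun_ifT => //.
- by apply: measurable_and => //; exact: measurable_fun_eqr.
- apply/measurable_EFinP; apply: measurable_funM.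
    exact: measurable_funX.
  exact: measurable_invX.
Qed.

(** For N = 0 the integrand is +oo at r = 0, so an atom there would make the moment infinite. *)
Lemma radial_measure_null0 : (0 < k)%N -> m [set 0%R] = 0.
Proof.
move=> k0; apply/eqP; apply: contraPT (m_bound 0) => m0.
apply/negP; rewrite -leNgt /radial_moment.
have <- : \int[m]_(r in [set 0%R]) (cst +oo r) = +oo.
  by rewrite integral_cst// gt0_mulye// lt0e m0 measure_ge0.
apply: (@le_trans _ _ (\int[m]_(r in [set 0%R]) h 0 r)).
  rewrite le_eqVlt; apply/orP; left; apply/eqP; apply: eq_integral => r.
  by rewrite inE /= => ->; rewrite /h expr0 expr0n (gtn_eqF k0) inve0 mul1e.
apply: ge0_subset_integral => //.
- by move=> r /=; rewrite in_itv/= andbT => r0; exact: h_ge0.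
- by move=> r /= ->; rewrite in_itv/= lexx.
Qed.

(** On ]0, +oo[ the integrand for N = k is 1, so the k-th moment bounds the mass. At 0 there is
    either no atom, or k = 0 and the integrand for N = 0 is 1. *)
Lemma radial_measure_lty : m setT < +oo.
Proof.
have mpos : m `]0%R, +oo[%classic < +oo.
  apply: le_lt_trans (m_bound k).
  rewrite -[leLHS]mul1e -integral_cst; last exact: measurable_itv.
  apply: (@le_trans _ _ (\int[m]_(r in `]0%R, +oo[) h k r)).
    rewrite le_eqVlt; apply/orP; left; apply/eqP; apply: eq_integral => r.
    rewrite inE /= in_itv/= andbT => r0; rewrite hE ?r0// mulfV//.
    by rewrite expf_neq0// gt_eqF.
  apply: ge0_subset_integral => //.
  - by move=> r /=; rewrite in_itv/= andbT => r0; exact: h_ge0.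
  - by move=> r /=; rewrite !in_itv/= !andbT => /ltW.
have m0 : m [set 0%R] < +oo.
  have [k0|k0] := posnP k; last by rewrite radial_measure_null0// ltry.
  apply: le_lt_trans (m_bound 0).
  rewrite -[leLHS]mul1e -integral_cst//.
  apply: (@le_trans _ _ (\int[m]_(r in [set 0%R]) h 0 r)).
    rewrite le_eqVlt; apply/orP; left; apply/eqP; apply: eq_integral => r _.
    by rewrite hE ?k0 ?orbT// expr0 invr1 mulr1.
  apply: ge0_subset_integral => //.
  - by move=> r /=; rewrite in_itv/= andbT => r0; exact: h_ge0.
  - by move=> r /= ->; rewrite in_itv/= lexx.
rewrite (_ : setT = `]-oo, 0%R[%classic `|` ([set 0%R] `|` `]0%R, +oo[%classic)); last first.
  apply/seteqP; split => // r _ /=; rewrite !in_itv/= andbT.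
  by case: (ltgtP r 0%R) => h0; [left|right; right|right; left].
apply: le_lt_trans (measureU2 _ _ _) _.
- exact: measurable_itv.
- by apply: measurableU => //; exact: measurable_itv.
rewrite [X in X + _](_ : _ = 0); last exact: m_support.
rewrite add0e; apply: le_lt_trans (measureU2 _ _ _) _ => //.
exact: lte_add_pinfty.
Qed.

Lemma radial_moment_le N :
  \int[m]_(r in halfline) ((1 + r ^+ N) * r ^- k)%:E <= radial_moment 0 + radial_moment N.
Proof.
have hp M r : halfline r -> 0 <= h M r.
  by rewrite /= in_itv/= andbT => r0; exact: h_ge0.
have <- : \int[m]_(r in halfline) (h 0 r + h N r) = radial_moment 0 + radial_moment N.
  by apply: ge0_integralD => //; [exact: hp|exact: hp].
apply: ge0_le_integral => //.
- move=> r /=; rewrite in_itv/= andbT => r0.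
  by rewrite lee_fin mulr_ge0 ?addr_ge0 ?invr_ge0 ?exprn_ge0.
- apply: measurable_funTS; apply/measurable_EFinP; apply: measurable_funM; last exact: measurable_invX.
  by apply: measurable_funD => //; exact: measurable_funX.
- by apply: emeasurable_funD; exact: mh.
- move=> r /=; rewrite in_itv/= andbT => r0.
  have [rk|] := boolP ((0 < r)%R || (k == 0)%N).
    by rewrite !hE// -EFinD expr0 mulrDl.
  rewrite negb_or -leNgt -lt0n => /andP[r0' k0].
  have -> : r = 0%R by apply/eqP; rewrite eq_le r0' r0.
  have -> : (0 ^+ k = 0 :> R)%R by rewrite expr0n (gtn_eqF k0).
  by rewrite invr0 mulr0 adde_ge0// h_ge0// lexx.
Qed.

End RadialMeasures.

(** * The moment functional in terms of real coefficients *)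

Section LaplaceFourier.
Context {R : realType} {d : nat}.
Variables (a : nat -> nat) (Y : forall k, 'I_(a k) -> mpoly d R).
Arguments Y : clear implicits.
Local Notation halfline := (`[0%R, +oo[%classic : set (measurableTypeR R)).
Local Open Scope complex_scope.

Definition quotient k (p y : mpoly d R) (r : R) : R :=
  if r == 0 then lim (sphere_coefficient p y s * s ^- k @[s --> 0^'+])
  else sphere_coefficient p y r * r ^- k.

Lemma laplace_fourierE k (l : 'I_(a k)) (f : mpoly d R[i]) (r : R) :
  laplace_fourier Y (cpeval f) l r =
  sphere_coefficient (coord_mpoly (@complex.Re R) f) (Y k l) r +i*
  sphere_coefficient (coord_mpoly (@complex.Im R) f) (Y k l) r.
Proof.
rewrite /laplace_fourier /cintegral; congr (_ +i* _).
  apply: eq_Rintegral => t _; rewrite -cpeval_Re.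
  by case: (cpeval _ _) => u v; rewrite /= mulr0 subr0.
apply: eq_Rintegral => t _; rewrite -cpeval_Im.
by case: (cpeval _ _) => u v; rewrite /= mulr0 add0r.
Qed.

Lemma laplace_fourier_quotientE k (l : 'I_(a k)) (f : mpoly d R[i]) (r : R) :
  laplace_fourier_quotient Y (cpeval f) l r =
  quotient k (coord_mpoly (@complex.Re R) f) (Y k l) r +i*
  quotient k (coord_mpoly (@complex.Im R) f) (Y k l) r.
Proof.
have qE s : laplace_fourier Y (cpeval f) l s * (s ^- k)%:C =
    (sphere_coefficient (coord_mpoly (@complex.Re R) f) (Y k l) s * s ^- k) +i*
    (sphere_coefficient (coord_mpoly (@complex.Im R) f) (Y k l) s * s ^- k).
  by rewrite laplace_fourierE; simpc.
rewrite /laplace_fourier_quotient /quotient; case: ifPn => _; last exact: qE.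
have q1 : (fun s => complex.Re (laplace_fourier Y (cpeval f) l s * (s ^- k)%:C)) =
    (fun s => sphere_coefficient (coord_mpoly (@complex.Re R) f) (Y k l) s * s ^- k).
  by apply/funext => s; rewrite qE.
have q2 : (fun s => complex.Im (laplace_fourier Y (cpeval f) l s * (s ^- k)%:C)) =
    (fun s => sphere_coefficient (coord_mpoly (@complex.Im R) f) (Y k l) s * s ^- k).
  by apply/funext => s; rewrite qE.
by rewrite q1 q2.
Qed.

(** The integrands can differ only at r = 0. For k = 0 they agree there by continuity; for k > 0 the
    point is null. *)
Lemma quotient_integral (m : {measure set (measurableTypeR R) -> \bar R}) k (p y : mpoly d R) :
  ((0 < k)%N -> m [set 0%R] = 0%E) ->
  \int[m]_(r in halfline) quotient k p y r =
  \int[m]_(r in halfline) (r ^- k * sphere_coefficient p y r).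
Proof.
move=> m0; have [k0|k0] := posnP k.
  apply: eq_Rintegral => r _; rewrite /quotient k0.
  case: eqP => [->|_]; last by rewrite mulrC.
  have -> : (fun s => sphere_coefficient p y s * s ^- 0) = sphere_coefficient p y.
    by apply/funext => s; rewrite expr0 invr1 mulr1.
  have -> : 0 ^- 0 = 1 :> R by rewrite expr0 invr1.
  by rewrite mul1r; apply/cvg_lim => //; exact: sphere_coefficient_cvg0.
rewrite /Rintegral; congr fine; apply: ae_eq_integral.
- exact: measurable_halfline.
- apply: measurable_funTS; apply/measurable_EFinP; apply: measurable_fun_ifT => //.
  + exact: measurable_fun_eqr.
  + apply: measurable_funM; last exact: measurable_invX.
    exact: measurable_sphere_coefficient.
- apply: measurable_funTS; apply/measurable_EFinP; apply: measurable_funM.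
    exact: measurable_invX.
  exact: measurable_sphere_coefficient.
- exists [set 0%R]; split => //; first exact: m0.
  move=> r /= /not_implyP[_]; rewrite /quotient; case: eqP => // _ []; congr EFin.
  exact: mulrC.
Qed.

Lemma moment_functional_coord
    (sigma : forall k, 'I_(a k) -> {measure set (measurableTypeR R) -> \bar R})
    (f : mpoly d R[i]) :
  (forall k l, (0 < k)%N -> sigma k l [set 0%R] = 0%E) ->
  let T (p : mpoly d R) := \sum_(k < mmeasure mdeg f) \sum_(l < a k)
    \int[sigma k l]_(r in halfline) (r ^- k * sphere_coefficient p (Y k l) r) in
  moment_functional Y sigma f =
  T (coord_mpoly (@complex.Re R) f) +i* T (coord_mpoly (@complex.Im R) f).
Proof.
move=> s0 T; rewrite /moment_functional /T.
have sumC (I : finType) (F G : I -> R) :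
    \sum_i (F i +i* G i) = (\sum_i F i) +i* (\sum_i G i).
  by apply/eqP; rewrite eq_complex !raddf_sum /= !eqxx.
rewrite -sumC; apply: eq_bigr => k _; rewrite -sumC; apply: eq_bigr => l _.
rewrite /cintegral; congr (_ +i* _).
  rewrite -quotient_integral//; last exact: s0.
  by apply: eq_Rintegral => r _; rewrite laplace_fourier_quotientE.
rewrite -quotient_integral//; last exact: s0.
by apply: eq_Rintegral => r _; rewrite laplace_fourier_quotientE.
Qed.

End LaplaceFourier.

Lemma compact_support_bounded (R : realType) (h : R -> R) :
  {within `[0, +oo[, continuous h} -> compact (closure [set r | 0 <= r /\ h r != 0]) ->
  exists2 B, 0 <= B & forall r, 0 <= r -> `|h r| <= B.
Proof.
set K := closure _ => ch cK.
(* Continuity is given only within the half-line, so the closure must be shown to stay inside it. *)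
have Khalf : K `<=` `[0, +oo[%classic.
  rewrite [X in _ `<=` X](closure_id _).1; last exact: rray_closed.
  by apply: closureS => r /= [r0 _]; rewrite in_itv/= r0.
have [M [_ hM]] := compact_bounded (continuous_compact (continuous_subspaceW Khalf ch) cK).
exists (`|M| + 1) => [|r r0]; first by rewrite addr_ge0.
have [->|hr] := eqVneq (h r) 0; first by rewrite normr0 addr_ge0.
apply: hM; first by rewrite (le_lt_trans (ler_norm _))// ltrDl.
by exists r => //; apply: subset_closure.
Qed.

(** * Construction of the charge and its three properties *)

Section Representation.
Context {R : realType} {d : nat}.
Variables (a : nat -> nat) (Y : forall k, 'I_(a k) -> mpoly d R).
Arguments Y : clear implicits.
Variable sigma : forall k, 'I_(a k) -> {measure set (measurableTypeR R) -> \bar R}.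
Arguments sigma : clear implicits.
Hypothesis Y_basis : orthonormal_harmonic_basis Y.
Hypothesis sigma_support : forall k l, sigma k l `]-oo, 0[%classic = 0%E.
Hypothesis sigma_bound : forall N, (moment_bound sigma N < +oo)%E.
Local Notation X := (euclidean R d).
Local Notation S := (@sphere R d).
Local Notation surf := (@surface_measure R d).
Local Notation halfline := (`[0%R, +oo[%classic : set (measurableTypeR R)).

Let Y_homog k l : Y k l \is ishomog1 k mdeg.
Proof. by have [h _ _] := Y_basis.1 k; apply: complexify_homog; exact: (h l).1. Qed.

Let Y_harmonic k l : \sum_(i < d) mderiv i (mderiv i (Y k l)) = 0.
Proof. by have [h _ _] := Y_basis.1 k; apply: complexify_harmonic; exact: (h l).2. Qed.

Let Y_orthonormal k (l l' : 'I_(a k)) :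
  \int[surf]_(t in S) (peval (Y k l) t * peval (Y k l') t) = (l == l')%:R.
Proof.
have [_ _ /(_ l l') h] := Y_basis.1 k.
have {h} : complex.Re (sphere_product (cpeval (complexify (Y k l)))
    (cpeval (complexify (Y k l')))) = (l == l')%:R.
  by rewrite h; case: (l == l').
have ReM (z w : R[i]) (u v : R) : z = u%:C%C -> w = v%:C%C -> complex.Re (z * w^*%C) = u * v.
  by move=> -> ->; rewrite /= oppr0 mulr0 subr0.
have fE t : complex.Re (cpeval (complexify (Y k l)) t * (cpeval (complexify (Y k l')) t)^*%C) =
    peval (Y k l) t * peval (Y k l') t.
  exact: ReM (cpeval_complexify (Y k l) t) (cpeval_complexify (Y k l') t).
rewrite /sphere_product /cintegral /= => <-.
by apply: eq_Rintegral => t _; rewrite fE.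
Qed.

(** The basis hypothesis concerns one degree at a time; across degrees the harmonic of higher degree
    is orthogonal to the other, seen as a mere polynomial of lower degree. *)
Let Y_orthogonal k k' (l : 'I_(a k)) (l' : 'I_(a k')) : k != k' ->
  \int[surf]_(t in S) (peval (Y k l) t * peval (Y k' l') t) = 0.
Proof.
have E p q : \int[surf]_(t in S) (peval p t * peval q t) = \int[surf]_(t in S) peval (p * q) t.
  by apply: eq_Rintegral => t _; rewrite /peval mevalM.
case: (ltngtP k k') => // kk _; rewrite E.
  apply: (sphere_orthogonal (Y_homog _) (Y_harmonic _)).
  exact: leq_trans (mmeasure_homog (Y_homog _)) kk.
rewrite mulrC; apply: (sphere_orthogonal (Y_homog _) (Y_harmonic _)).
exact: leq_trans (mmeasure_homog (Y_homog _)) kk.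
Qed.

Let radial_moment_ge0 k l N : (0 <= radial_moment (sigma k l) k N)%E.
Proof.
apply: integral_ge0 => r /=; rewrite in_itv/= andbT => r0.
by rewrite mule_ge0 ?inve_ge0 ?lee_fin ?exprn_ge0.
Qed.

Let radial_moment_lty k l N : (radial_moment (sigma k l) k N < +oo)%E.
Proof.
apply: le_lt_trans (sigma_bound N).
rewrite /moment_bound (@nneseriesD1 _ _ k)// => [|i _]; last first.
  by apply: sume_ge0 => j _; exact: radial_moment_ge0.
rewrite (bigD1 l)//= -addeA leeDl// adde_ge0//.
  by apply: sume_ge0 => j _; exact: radial_moment_ge0.
by apply: nneseries_ge0 => i _ _; apply: sume_ge0 => j _; exact: radial_moment_ge0.
Qed.

Let s k (l : 'I_(a k)) : {finite_measure set (measurableTypeR R) -> \bar R} :=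
  finite_of (radial_measure_lty (sigma_support l) (radial_moment_lty l)).

Let sphere_L1_bound : R := fine (surf S) + 1.

(* |y| <= 1 + y^2, and Y_{k,l} has L^2 norm 1. *)
Let Y_L1 k l : (\int[surf]_(t in S) `|peval (Y k l) t|%:E <= sphere_L1_bound%:E)%E.
Proof.
have mS := @measurable_sphere R d.
have iS q : surf.-integrable S (EFin \o peval q).
  by apply: integrableS (integrable_surface_measure q).
have -> : sphere_L1_bound = \int[surf]_(t in S) peval (1 + Y k l * Y k l) t.
  transitivity (\int[surf]_(t in S) (peval 1 t + peval (Y k l * Y k l) t)).
    rewrite RintegralD// /sphere_L1_bound; congr (_ + _).
      rewrite -[LHS]mul1r -Rintegral_cst//; apply: eq_Rintegral => t _.
      by rewrite /peval meval1.
    transitivity ((l == l)%:R : R); first by rewrite eqxx.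
    by rewrite -Y_orthonormal; apply: eq_Rintegral => t _; rewrite /peval mevalM.
  by apply: eq_Rintegral => t _; rewrite /peval mevalD.
rewrite /Rintegral fineK; last exact: (integrable_fin_num mS (iS _)).
apply: ge0_le_integral => //.
- apply: measurable_funTS; apply/measurable_EFinP; apply: measurableT_comp => //.
  exact: measurable_peval.
- by apply: measurable_funTS; apply/measurable_EFinP; exact: measurable_peval.
- move=> t _; rewrite lee_fin /peval mevalD meval1 mevalM -/(peval _ _).
  rewrite -expr2 -real_normK ?num_real//.
  have [h|h] := leP `|peval (Y k l) t| 1; first by rewrite (le_trans h)// lerDl exprn_ge0.
  by rewrite (@le_trans _ _ (`|peval (Y k l) t| ^+ 2)) ?lerDr// expr2 ler_peMl// ltW.
Qed.

(** The constant c is uniform in k and l, so the whole series is at most c times [moment_bound] at 0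
    plus that at N. *)
Let series_bound (g : forall k, 'I_(a k) -> \bar R) (c : R) N : 0 <= c ->
  (forall k l, 0 <= g k l)%E ->
  (forall k l, g k l <= c%:E * (radial_moment (sigma k l) k 0 + radial_moment (sigma k l) k N))%E ->
  (\sum_(k <oo) \sum_(l < a k) g k l < +oo)%E.
Proof.
move=> c0 g0 gc.
have S0 M k : (0 <= \sum_(l < a k) radial_moment (sigma k l) k M)%E.
  by apply: sume_ge0 => l _; exact: radial_moment_ge0.
apply: (@le_lt_trans _ _ (c%:E * (moment_bound sigma 0 + moment_bound sigma N))%E).
  rewrite /moment_bound -nneseriesD; [|by move=> k _ _; exact: S0..].
  rewrite -nneseriesZl; last by move=> k _; rewrite adde_ge0//; exact: S0.
  apply: lee_nneseries => [k _ _|k _]; first by apply: sume_ge0.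
  rewrite -big_split/= ge0_sume_distrr => [|l _]; last by rewrite adde_ge0 ?radial_moment_ge0.
  by apply: lee_sum => l _; exact: gc.
have b0 M : (0 <= moment_bound sigma M)%E by apply: nneseries_ge0 => k _ _; exact: S0.
by apply: lte_mul_pinfty; rewrite ?lee_fin// lte_add_pinfty.
Qed.

(** The interface from which all three conclusions follow: its growth condition covers polynomials
    as well as h(|x|) Y_{k,l}(x) with bounded h. *)
Definition represents (mu : {charge set X -> \bar R}) : Prop :=
  forall (f : X -> R) C N,
    measurable_fun setT f -> (forall x, `|f x| <= C * (1 + enorm x ^+ N)) ->
    (Defs.total_variation mu).-integrable setT (EFin \o f) /\
    \sum_(k < n) \sum_(l < a k) \int[sigma k l]_(r in halfline)
        (r ^- k * \int[surf]_(t in S) (f (r *: (t : 'rV[R]_d)) * peval (Y k l) t))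
      @[n --> \oo] --> signed_integral mu f.

Lemma representing_charge : exists mu, represents mu.
Proof.
have [su suE] := finite_measureP (@surface_measure_lty R d).
have suI D (g : X -> \bar R) : (\int[su]_(t in D) g t = \int[surf]_(t in D) g t)%E.
  by apply: eq_measure_integral => A _ _; have := congr1 (fun m => m A) suE.
have iy k l : su.-integrable setT (EFin \o peval (Y k l)).
  have /integrableP[my iy] := integrable_surface_measure (Y k l).
  by apply/integrableP; split => //; rewrite suI.
have pm k l N : (polar_moment (s l) k N <=
    radial_moment (sigma k l) k 0 + radial_moment (sigma k l) k N)%E.
  exact: radial_moment_le.
have pm0 k (l : 'I_(a k)) N : (0 <= polar_moment (s l) k N)%E.
  apply: integral_ge0 => r /=; rewrite in_itv/= andbT => r0.
  by rewrite lee_fin mulr_ge0 ?addr_ge0 ?invr_ge0 ?exprn_ge0.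
have L0 : 0 <= sphere_L1_bound by rewrite addr_ge0 ?fine_ge0.
have C_ge0 (f : X -> R) C N : (forall x, `|f x| <= C * (1 + enorm x ^+ N)) -> 0 <= C.
  move=> bf; have := le_trans (normr_ge0 _) (bf (0 : 'rV[R]_d)).
  by rewrite pmulr_lge0// ltr_pwDl// exprn_ge0// enorm_ge0.
have bound k l C N : 0 <= C ->
    (C%:E * (polar_moment (s l) k N * \int[su]_(t in S) `|peval (Y k l) t|%:E) <=
     (C * sphere_L1_bound)%:E *
       (radial_moment (sigma k l) k 0 + radial_moment (sigma k l) k N))%E.
  move=> C0; rewrite EFinM -muleA lee_wpmul2l ?lee_fin// muleC suI.
  apply: lee_pmul => //; apply: integral_ge0 => t _; by rewrite lee_fin.
pose np k l := polar_pos (s l) su k (Y k l).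
pose nn k l := polar_neg (s l) su k (Y k l).
have sp (f : X -> R) C N : measurable_fun setT f ->
    (forall x, `|f x| <= C * (1 + enorm x ^+ N)) ->
    (\sum_(k <oo) \sum_(l < a k) \int[np k l]_x `|(f x)%:E| < +oo)%E.
  move=> mf bf; have C0 := C_ge0 f C N bf.
  apply: (series_bound (mulr_ge0 C0 L0)) => [k l|k l]; first exact: integral_ge0.
  exact: le_trans (polar_pos_le (s l) su k (Y k l) mf bf) (bound k l C N C0).
have sn (f : X -> R) C N : measurable_fun setT f ->
    (forall x, `|f x| <= C * (1 + enorm x ^+ N)) ->
    (\sum_(k <oo) \sum_(l < a k) \int[nn k l]_x `|(f x)%:E| < +oo)%E.
  move=> mf bf; have C0 := C_ge0 f C N bf.
  apply: (series_bound (mulr_ge0 C0 L0)) => [k l|k l]; first exact: integral_ge0.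
  exact: le_trans (polar_neg_le (s l) su k (Y k l) mf bf) (bound k l C N C0).
(* The constant function 1 turns the summability estimates into finiteness of the total masses. *)
have b1 (x : X) : `|1 : R| <= 1 * (1 + enorm x ^+ 0) by rewrite normr1 mul1r expr0 lerDl.
have mass (m : {measure set X -> \bar R}) : (\int[m]_x `|((cst 1 : X -> R) x)%:E| = m setT)%E.
  rewrite (eq_integral (cst 1%E)) => [|x _]; last by rewrite /= normr1.
  by rewrite integral_cst// mul1e.
have [mu muP] : exists mu : {charge set X -> \bar R}, forall f : X -> R,
    measurable_fun setT f ->
    (\sum_(k <oo) \sum_(l < a k) \int[np k l]_x `|(f x)%:E| < +oo)%E ->
    (\sum_(k <oo) \sum_(l < a k) \int[nn k l]_x `|(f x)%:E| < +oo)%E ->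
    (Defs.total_variation mu).-integrable setT (EFin \o f) /\
    \sum_(k < n) \sum_(l < a k) (\int[np k l]_x f x - \int[nn k l]_x f x)
      @[n --> \oo] --> signed_integral mu f.
  apply: signed_series.
    apply: le_lt_trans (sp (cst 1) 1 0 (measurable_cst _) b1).
    apply: lee_nneseries => [k _ _|k _]; first by apply: sume_ge0.
    by apply: lee_sum => l _; rewrite -(mass (np k l)).
  apply: le_lt_trans (sn (cst 1) 1 0 (measurable_cst _) b1).
  apply: lee_nneseries => [k _ _|k _]; first by apply: sume_ge0.
  by apply: lee_sum => l _; rewrite -(mass (nn k l)).
exists mu => f C N mf bf.
have [tv lim] := muP f mf (sp f C N mf bf) (sn f C N mf bf).
split => //; apply: cvg_trans lim; apply: near_eq_cvg; apply: nearW => n.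
apply: eq_bigr => k _; apply: eq_bigr => l _.
have iN : (polar_moment (s l) k N < +oo)%E.
  by apply: le_lt_trans (pm k l N) _; rewrite lte_add_pinfty.
rewrite (polar_signed_integral mf bf (iy k l) iN).
by apply: eq_Rintegral => r _; rewrite /Rintegral suI.
Qed.

Section Represented.
Variable mu : {charge set X -> \bar R}.
Hypothesis mu_represents : represents mu.

(** The partial sums are constant from the degree on, by orthogonality. Any later cut n is allowed,
    so that real and imaginary parts of one polynomial can share theirs. *)
Lemma represents_peval p :
  (Defs.total_variation mu).-integrable setT (EFin \o peval p) /\
  forall n, (mmeasure mdeg p <= n)%N ->
    \sum_(k < n) \sum_(l < a k) \int[sigma k l]_(r in halfline)
      (r ^- k * sphere_coefficient p (Y k l) r) = signed_integral mu (peval p).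
Proof.
have [C _ bp] := peval_bound p.
have [tv lim] := mu_represents (measurable_peval p) bp; split => // n pn.
apply/esym/(cvg_unique _ lim) => //; apply: cvg_near_cst; near=> m.
have nm : (n <= m)%N by near: m; exact: nbhs_infty_ge.
rewrite -(subnKC nm) big_split_ord/= [X in _ + X]big1 ?addr0// => k _.
rewrite big1// => l _; rewrite (_ : Rintegral _ _ _ = \int[sigma (rshift n k) l]_(r in halfline) 0).
  by rewrite /Rintegral integral0.
apply: eq_Rintegral => r _.
rewrite -/(sphere_coefficient p (Y (rshift n k) l) r).
by rewrite (sphere_coefficient_eq0 _ (Y_homog l) (Y_harmonic l)) ?mulr0// (leq_trans pn)//= leq_addr.
Unshelve. all: by end_near. Qed.

Lemma represents_moment_measure : moment_measure mu.
Proof.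
move=> f; split.
  rewrite (_ : (fun x => _) = EFin \o peval (coord_mpoly (@complex.Re R) f)); last first.
    by apply/funext => x; rewrite /= -cpeval_Re.
  exact: (represents_peval _).1.
rewrite (_ : (fun x => _) = EFin \o peval (coord_mpoly (@complex.Im R) f)); last first.
  by apply/funext => x; rewrite /= -cpeval_Im.
exact: (represents_peval _).1.
Qed.

Lemma represents_moment_functional (f : mpoly d R[i]) :
  moment_functional Y sigma f = csigned_integral mu (cpeval f).
Proof.
rewrite moment_functional_coord => [|k l k0]; last first.
  by apply: radial_measure_null0 k0 => N; exact: radial_moment_lty.
have ReE : (fun x => complex.Re (cpeval f x)) = peval (coord_mpoly (@complex.Re R) f).
  by apply/funext => x; exact: cpeval_Re.
have ImE : (fun x => complex.Im (cpeval f x)) = peval (coord_mpoly (@complex.Im R) f).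
  by apply/funext => x; exact: cpeval_Im.
have hRe := etrans ((represents_peval _).2 _ (mmeasure_coord_mpoly _ f))
  (f_equal (signed_integral mu) (esym ReE)).
have hIm := etrans ((represents_peval _).2 _ (mmeasure_coord_mpoly _ f))
  (f_equal (signed_integral mu) (esym ImE)).
have C2 (A B u v : R) : A = u -> B = v -> (A +i* B = u +i* v)%C by move=> -> ->.
exact: (C2 _ _ _ _ hRe hIm).
Qed.

(** Every partial sum is non-negative: by homogeneity the inner integral in the term (k',l') is h(r)
    r^k times 1 or 0, according to orthonormality. *)
Lemma represents_pseudo_positive : pseudo_positive Y mu.
Proof.
move=> h ch h0 Kh k l.
have [B B0 hB] := compact_support_bounded ch Kh.
have [C C0 bY] := peval_bound (Y k l).
set N := mmeasure _ _ in bY.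
have mf : measurable_fun setT (fun x : X => h (enorm x) * peval (Y k l) x).
  apply: measurable_funM; last exact: measurable_peval.
  (* Nothing is known of h on negative reals; extending it by 0 changes nothing after composition
     with the norm. *)
  have mh : measurable_fun setT (h \_ halfline : measurableTypeR R -> R).
    apply: (measurable_restrictT _ _).1; first exact: measurable_halfline.
    exact: (@subspace_continuous_measurable_fun _ _ h).
  have -> : (fun x : X => h (enorm x)) = (h \_ halfline) \o (@enorm R d).
    apply/funext => x; rewrite /= patchE mem_set//= in_itv/= andbT.
    exact: enorm_ge0.
  exact: (measurableT_comp mh (@measurable_enorm R d)).
have bf (x : X) : `|h (enorm x) * peval (Y k l) x| <= B * C * (1 + enorm x ^+ N).
  by rewrite normrM -mulrA ler_pM// hB// enorm_ge0.
have [_ lim] := mu_represents mf bf.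
rewrite -(cvg_lim _ lim)//; apply: limr_ge; first by apply: cvgP lim.
apply: nearW => n; apply: sumr_ge0 => k' _; apply: sumr_ge0 => l' _.
apply: Rintegral_ge0 => r /=; rewrite in_itv/= andbT => r0.
apply: mulr_ge0; first by rewrite invr_ge0 exprn_ge0.
have -> : \int[surf]_(t in S) (h (enorm (r *: (t : 'rV[R]_d) : X)) *
      peval (Y k l) (r *: (t : 'rV[R]_d)) * peval (Y k' l') t) =
    h r * r ^+ k * \int[surf]_(t in S) (peval (Y k l) t * peval (Y k' l') t).
  have iYY : surf.-integrable S (EFin \o (fun t => peval (Y k l) t * peval (Y k' l') t)).
    rewrite (_ : (fun t => _) = peval (Y k l * Y k' l')); last first.
      by apply/funext => t; rewrite /peval mevalM.
    apply: integrableS (integrable_surface_measure _) => //; exact: measurable_sphere.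
  rewrite -(RintegralZl _ (@measurable_sphere R d) iYY).
  apply: eq_Rintegral => t; rewrite inE => tS.
  by rewrite enormZ// tS mulr1 (peval_homog _ _ (Y_homog l)) !mulrA.
apply: mulr_ge0; first by rewrite mulr_ge0 ?h0 ?exprn_ge0.
have [kk|kk] := eqVneq k k'; last by rewrite (Y_orthogonal l l' kk).
(* The degrees must be identified first, since l and l' have different types until then. *)
by rewrite -kk in l' *; rewrite Y_orthonormal.
Qed.

End Represented.

End Representation.

Theorem theorem9 (R : realType) (d : nat) (d_ge1 : (1 <= d)%N)
  (a : nat -> nat) (Y : forall k : nat, 'I_(a k) -> mpoly d R)
  (Y_basis : orthonormal_harmonic_basis Y)
  (sigma : forall k : nat, 'I_(a k) -> {measure set (measurableTypeR R) -> \bar R})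
  (sigma_support : forall (k : nat) (l : 'I_(a k)), sigma k l `]-oo, 0[%classic = 0%E)
  (sigma_bound : forall N : nat, (moment_bound sigma N < +oo)%E) :
  exists mu : {charge set (euclidean R d) -> \bar R},
    [/\ pseudo_positive Y mu,
        moment_measure mu
      & forall f : mpoly d R[i],
          moment_functional Y sigma f = csigned_integral mu (cpeval f)].
Proof.
have [mu mu_represents] := representing_charge Y_basis sigma_support sigma_bound.
exists mu; split.
- exact: (represents_pseudo_positive Y_basis mu_represents).
- exact: (represents_moment_measure Y_basis mu_represents).
- exact: (represents_moment_functional Y_basis sigma_bound mu_represents).
Qed.
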